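(* Let $p$ be a prime, let $k\ge 0$ be an integer, and let $\mathcal S$ be a $\mathbb Z_p$-combinatorial $d$-sphere. Let $f:\operatorname{Bd}^k(\mathcal S)\to\mathcal S$ be a $\mathbb Z_p$-equivariant simplicial map (with respect to the $\mathbb Z_p$-action on $\operatorname{Bd}^k(\mathcal S)$ induced by that on $\mathcal S$). Then the combinatorial degree of $f$ satisfies \[\deg(f)\equiv 1 \pmod p.\]
   Context: A simplicial complex $\mathcal K$ is a finite nonempty collection of finite sets closed under taking subsets (so $\emptyset\in\mathcal K$); its elements are simplices, $\dim\sigma=|\sigma|-1$, a $q$-simplex has dimension $q$, $\dim\mathcal K$ is the largest dimension of a simplex, $V(\mathcal K)=\bigcup_{\sigma\in\mathcal K}\sigma$, and $\alpha$ is a facet of $\beta$ if $\alpha\subseteq\beta$ and $\dim\alpha=\dim\beta-1$. A total order on $V(\mathcal K)$ is fixed; a $q$-simplex with vertices $x_0<\dots<x_q$ is regarded as the oriented simplex $[x_0,\dots,x_q]$. $C_q(\mathcal K)$ is the free $\mathbb Z$-module with basis the set $S_q(\mathcal K)$ of $q$-simplices ($q\ge 0$), and $C_q=0$ for $q<0$ or $q>\dim\mathcal K$. For a $q$-simplex $\sigma=[x_0,\dots,x_q]$ and a $(q-1)$-simplex $\tau$ (for $q=0$, $\tau=\emptyset$), the incidence number $[\sigma,\tau]$ is $(-1)^i$ if $\tau=\sigma\setminus\{x_i\}$ and $0$ if $\tau\not\subseteq\sigma$. The boundary map is $\partial_q(\sigma)=\sum_{\tau\in S_{q-1}(\mathcal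 K)}[\sigma,\tau]\tau$ for $q\ge1$, and $\partial_0=0$. A discrete vector field $\mathcal V$ on $\mathcal K$ is a set of ordered pairs $(\alpha,\beta)$ of simplices of $\mathcal K$ ($\alpha=\emptyset$ allowed) with $\alpha$ a facet of $\beta$, such that each simplex lies in at most one pair. For $q$-simplices $\beta_0,\beta_r$, a $\mathcal V$-trajectory from $\beta_0$ to $\beta_r$ is a sequence $\beta_0,\alpha_1,\beta_1,\dots,\alpha_r,\beta_r$ ($r\ge0$) of alternately $q$- and $(q-1)$-simplices with $(\alpha_i,\beta_i)\in\mathcal V$, $\alpha_i\subsetneq\beta_{i-1}$ and $\beta_{i-1}\neq\beta_i$ for all $i$; it is nontrivial closed if $r>0$ and $\beta_r=\beta_0$. A gradient vector field is a discrete vector field with no nontrivial closed trajectory. A nonempty simplex $\sigma$ is $\mathcal V$-critical if it lies in no pair of $\mathcal V$, or if it is a $0$-simplex with $(\emptyset,\sigma)\in\mathcal V$. A $d$-dimensional pseudomanifold is a simplicial complex all of whose maximal simplices have dimension $d$, such that every $(d-1)$-simplex lies in exactly two $d$-simplices, and any two $d$-simplices $\alpha,\beta$ are joined by a sequence $\alpha=\alpha_0,\alpha_1,\dots,\alpha_n=\beta$ of $d$-simplices with $\alpha_i\cap\alpha_{i+1}$ a $(d-1)$-simplex. A combinatorial $d$-sphere is a $d$-dimensional pseudomanifold admitting a gradient vector field with exactly two critical simplices, one of dimension $d$ and one of dimension $0$. If $\sigma_1,\dots,\sigma_n$ are its $d$-simplices, an orientation is a tuple $\xi=(\xi_1,\dots,\xi_n)\in\{\pm1\}^n$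 with $\partial_d(\sum\xi_i\sigma_i)=0$, and $[\mathcal S_\xi]=\sum\xi_i\sigma_i$ is the fundamental cycle. The barycentric subdivision $\operatorname{Bd}(\mathcal K)$ has a vertex $v_\sigma$ for each nonempty $\sigma\in\mathcal K$, and its simplices are the sets $\{v_{\sigma_0},\dots,v_{\sigma_n}\}$ with $\sigma_0\subsetneq\dots\subsetneq\sigma_n$ (plus $\emptyset$); $\operatorname{Bd}^0(\mathcal K)=\mathcal K$, $\operatorname{Bd}^k=\operatorname{Bd}(\operatorname{Bd}^{k-1})$. A simplicial map $f:\mathcal K_1\to\mathcal K_2$ is a map $V(\mathcal K_1)\to V(\mathcal K_2)$ sending simplices to simplices; it induces the chain map $f_q([v_0,\dots,v_q])=[f(v_0),\dots,f(v_q)]$ (an oriented simplex, i.e. the sign of the sorting permutation times the sorted simplex) if the $f(v_i)$ are distinct, and $0$ otherwise. The subdivision chain map $g_\#:C_\#(\mathcal K)\to C_\#(\operatorname{Bd}(\mathcal K))$ is the standard one: $g_0(v)=v_{\{v\}}$ and $g_q(\sigma)=v_\sigma * g_{q-1}(\partial_q\sigma)$ for $q\ge1$, where $v*[w_0,\dots,w_{q-1}]=[v,w_0,\dots,w_{q-1}]$; $g^k_\#:C_\#(\mathcal K)\to C_\#(\operatorname{Bd}^k(\mathcal K))$ is the $k$-fold composite. A group $G$ acts simplicially on $\mathcal K$ if each $g\in G$ acts by a simplicial automorphism, compatibly with the group law and with $e$ acting trivially; $\operatorname{Bd}^k(\mathcal K)$ inherits the action $g\cdot v_\sigma=v_{g\cdot\sigma}$.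 A simplicial map between $G$-complexes is $G$-equivariant if $f(g\cdot\sigma)=g\cdot f(\sigma)$. A $\mathbb Z_p$-combinatorial sphere is a combinatorial sphere with a free simplicial $\mathbb Z_p$-action (no non-identity element maps a nonempty simplex to itself). Combinatorial degree: for a combinatorial $d$-sphere $\mathcal S$ and a simplicial map $f:\operatorname{Bd}^k(\mathcal S)\to\mathcal S$, $\operatorname{Bd}^k(\mathcal S)$ is a combinatorial $d$-sphere, and $\deg(f)$ is the integer $m$ with $(g^k_d\circ f_d)([\operatorname{Bd}^k(\mathcal S)_\xi])=m\,[\operatorname{Bd}^k(\mathcal S)_\xi]$ for an orientation $\xi$ of $\operatorname{Bd}^k(\mathcal S)$ (such $m$ exists and does not depend on the choice of $\xi$). *)

(* Defs.v *)
From HB Require Import structures.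
From mathcomp Require Import all_boot all_order all_algebra all_fingroup.

Set Implicit Arguments.
Unset Strict Implicit.
Unset Printing Implicit Defensive.

Import GRing.Theory.
Local Open Scope ring_scope.

(* The simplices of K with n vertices, that is, of dimension n - 1; the set
   S_q(K) of q-simplices is [faces K q.+1], and [faces K 0] is {set0}. *)
Definition faces (T : finType) (K : {set {set T}}) (n : nat) : {set {set T}} :=
  [set s in K | #|s| == n].

Definition is_complex (T : finType) (K : {set {set T}}) : Prop :=
  K != set0 /\ (forall s t : {set T}, s \in K -> t \subset s -> t \in K).

Definition total_order (T : eqType) (le : rel T) : Prop :=
  [/\ reflexive le, antisymmetric le, transitive le & total le].

Definition is_facet (T : finType) (a b : {set T}) : bool :=
  (a \subset b) && (#|b| == #|a|.+1).

Definition discrete_vector_field (T : finType) (K : {set {set T}})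
    (V : {set {set T} * {set T}}) : Prop :=
  (forall P, P \in V -> [/\ P.1 \in K, P.2 \in K & is_facet P.1 P.2]) /\
  (forall (s : {set T}) P Q, P \in V -> Q \in V ->
     s \in [:: P.1; P.2] -> s \in [:: Q.1; Q.2] -> P = Q).

(* With w = [:: (a_1, b_1); ..; (a_r, b_r)], this says that
   b, a_1, b_1, .., a_r, b_r is a V-trajectory of q- and (q-1)-simplices. *)
Fixpoint trajectory (T : finType) (K : {set {set T}})
    (V : {set {set T} * {set T}}) (q : nat) (b : {set T})
    (w : seq ({set T} * {set T})) : bool :=
  (b \in faces K q.+1) &&
  (if w is (a', b') :: w' then
     [&& a' \in faces K q, (a', b') \in V, a' \proper b, b != b'
       & trajectory K V q b' w']
   else true).

Definition gradient_vector_field (T : finType) (K : {set {set T}})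
    (V : {set {set T} * {set T}}) : Prop :=
  discrete_vector_field K V /\
  (forall q b w, trajectory K V q b w -> w != [::] -> last b (unzip2 w) != b).

Definition critical (T : finType) (K : {set {set T}})
    (V : {set {set T} * {set T}}) : {set {set T}} :=
  [set s in K | (s != set0) &&
     ([forall P in V, s \notin [:: P.1; P.2]] ||
      ((#|s| == 1)%N && ((set0, s) \in V)))].

Definition adjacent (T : finType) (K : {set {set T}}) (d : nat) :
    rel {set T} :=
  fun a b => [&& a \in faces K d.+1, b \in faces K d.+1
               & a :&: b \in faces K d].

Definition pseudomanifold (T : finType) (d : nat) (K : {set {set T}}) : Prop :=
  [/\ is_complex K,
      forall s, maxset (mem K) s -> #|s| = d.+1,
      forall t, t \in faces K d -> #|[set s in faces K d.+1 | t \subset s]| = 2%N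
    & forall a b, a \in faces K d.+1 -> b \in faces K d.+1 ->
        connect (adjacent K d) a b].

Definition combinatorial_sphere (T : finType) (d : nat) (K : {set {set T}}) :
    Prop :=
  pseudomanifold d K /\
  exists V, gradient_vector_field K V /\
    exists s t, [/\ critical K V = [set s; t], s != t, #|s| = d.+1 & #|t| = 1%N].

(* C_q(K) is the subgroup of the functions supported on
   [faces K q.+1]; the maps below on q-chains of K only read the coefficients
   at these simplices. *)
Definition chain (T : finType) := {ffun {set T} -> int}.

Definition simplex_chain (T : finType) (s : {set T}) : chain T :=
  [ffun t => (t == s)%:R].

(* The vertices x_0 < ... < x_q of a simplex. *)
Definition vseq (T : finType) (le : rel T) (s : {set T}) : seq T :=
  sort le (enum s).

(* The sign of the permutation sorting s; for a total order and a
   duplicate-free s exactly one permutation occurs in the sum. *)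
Definition sort_sign (T : finType) (le : rel T) (s : seq T) : int :=
  \sum_(pi : 'S_(size s) |
      sorted le [seq tnth (in_tuple s) (pi i) | i : 'I_(size s)]) (-1) ^+ pi.

(* The oriented simplex [x_0, .., x_q], and 0 if two x_i coincide. *)
Definition oriented (T : finType) (le : rel T) (s : seq T) : chain T :=
  if uniq s then simplex_chain [set x in s] *~ sort_sign le s else 0.

(* At most one index i contributes to the sum. *)
Definition incidence (T : finType) (le : rel T) (s t : {set T}) : int :=
  \sum_(i < size (vseq le s) | t == s :\ tnth (in_tuple (vseq le s)) i)
     (-1) ^+ i.

Definition boundary (T : finType) (K : {set {set T}}) (le : rel T) (q : nat)
    (c : chain T) : chain T :=
  if q is q'.+1 then
    \sum_(s in faces K q.+1)
      (\sum_(t in faces K q) simplex_chain t *~ incidence le s t) *~ c s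
  else 0.

Definition fund_cycle (T : finType) (K : {set {set T}}) (d : nat)
    (xi : {ffun {set T} -> int}) : chain T :=
  \sum_(s in faces K d.+1) simplex_chain s *~ xi s.

(* Only the values of xi at the d-simplices matter. *)
Definition orientation (T : finType) (K : {set {set T}}) (le : rel T) (d : nat)
    (xi : {ffun {set T} -> int}) : Prop :=
  (forall s, s \in faces K d.+1 -> xi s = 1 \/ xi s = -1) /\
  boundary K le d (fund_cycle K d xi) = 0.

Definition simplicial_map (T1 T2 : finType) (K1 : {set {set T1}})
    (K2 : {set {set T2}}) (f : T1 -> T2) : Prop :=
  forall s : {set T1}, s \in K1 -> f @: s \in K2.

Definition map_chain (T1 T2 : finType) (K1 : {set {set T1}})
    (le1 : rel T1) (le2 : rel T2) (f : T1 -> T2) (q : nat) (c : chain T1) :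
    chain T2 :=
  \sum_(s in faces K1 q.+1) oriented le2 (map f (vseq le1 s)) *~ c s.

(* Barycentric subdivision; the vertex v_s is the simplex s itself. *)

Definition Bd (T : finType) (K : {set {set T}}) : {set {set {set T}}} :=
  [set A : {set {set T}} | (A \subset K :\ set0) &&
     [exists w : #|A|.-tuple {set T},
        sorted (fun a b : {set T} => a \proper b) w && (A == [set x in w])]].

Definition cone (T : finType) (le : rel T) (v : T) (c : chain T) : chain T :=
  \sum_(t : {set T}) oriented le (v :: vseq le t) *~ c t.

Fixpoint subdiv_chain (T : finType) (K : {set {set T}}) (le : rel T)
    (le' : rel {set T}) (q : nat) (c : chain T) : chain {set T} :=
  match q with
  | 0 => \sum_(s in faces K 1) simplex_chain [set s] *~ c s
  | q'.+1 => \sum_(s in faces K q.+1)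
      cone le' s (subdiv_chain K le le' q' (boundary K le q (simplex_chain s)))
        *~ c s
  end.

Fixpoint bdV (T : finType) (k : nat) : finType :=
  if k is k'.+1 then {set bdV T k'} : finType else T.

Fixpoint iter_Bd (T : finType) (K : {set {set T}}) (k : nat) :
    {set {set bdV T k}} :=
  match k with
  | 0 => K
  | k'.+1 => Bd (iter_Bd K k')
  end.

(* The map g^k on q-chains; [le j] is the order on the vertices of Bd^j(K). *)
Fixpoint iter_subdiv_chain (T : finType) (K : {set {set T}})
    (le : forall j, rel (bdV T j)) (k q : nat) (c : chain T) :
    chain (bdV T k) :=
  match k with
  | 0 => c
  | k'.+1 => @subdiv_chain (bdV T k') (iter_Bd K k') (le k') (le k'.+1) q
               (iter_subdiv_chain K le k' q c)
  end.

(* m is a degree of f : Bd^k(S) -> S.  The relation is functional when d > 0.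
   For d = 0 every tuple of signs is an orientation, as boundary 0 = 0, and the
   value may depend on xi. *)
Definition is_degree (T : finType) (S : {set {set T}})
    (le : forall j, rel (bdV T j)) (d k : nat) (f : bdV T k -> T) (m : int) :
    Prop :=
  exists xi, orientation (iter_Bd S k) (le k) d xi /\
    iter_subdiv_chain S le k d
      (map_chain (iter_Bd S k) (le k) (le 0%N) f d (fund_cycle (iter_Bd S k) d xi))
    = fund_cycle (iter_Bd S k) d xi *~ m.

(* Actions in the library are right actions; for the abelian
   groups 'Z_p this is the same notion.  [to^*] is the action on sets of
   vertices. *)
Definition simplicial_action (gT : finGroupType) (T : finType)
    (K : {set {set T}}) (to : {action gT &-> T}) : Prop :=
  [acts [set: gT], on K | to^*].

Definition free_action (gT : finGroupType) (T : finType)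
    (K : {set {set T}}) (to : {action gT &-> T}) : Prop :=
  forall (g : gT) (s : {set T}),
    g != 1%g -> s \in K -> s != set0 -> (to^*)%act s g != s.

Fixpoint iter_act (gT : finGroupType) (T : finType) (to : {action gT &-> T})
    (k : nat) : {action gT &-> bdV T k} :=
  match k with
  | 0 => to
  | k'.+1 => ((iter_act to k')^*)%act
  end.

Definition equivariant (gT : finGroupType) (T1 T2 : finType)
    (K1 : {set {set T1}}) (to1 : {action gT &-> T1}) (to2 : {action gT &-> T2})
    (f : T1 -> T2) : Prop :=
  forall (g : gT) (s : {set T1}), s \in K1 ->
    f @: (to1^*)%act s g = (to2^*)%act (f @: s) g.

Definition Zp_combinatorial_sphere (p : nat) (T : finType) (d : nat)
    (K : {set {set T}}) (to : {action 'Z_p &-> T}) : Prop :=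
  [/\ combinatorial_sphere d K, simplicial_action K to & free_action K to].

(* Main.v *)
(* The composite c |-> f_#(g^k(c)) - c is an equivariant chain map of the
   augmented complex of S. The gradient vector field makes this complex exact
   below dimension d and the action is free, so an equivariant homotopy h can
   be built up to dimension d - 1; on d-simplices the defect c |-> f_#(g^k(c))
   - c - h(boundary c) is then equivariant with values in the cycles, that is,
   in the multiples of the fundamental cycle Z. Its coefficients, multiplied by
   those of Z, are constant on the free orbits of d-simplices, and their sum is
   deg f - 1, which is therefore a multiple of p.
   Any orientation of Bd^k(S) is a multiple of g^k(Z): a top-dimensional cycle
   z of Bd(K) equals g(v_#(z)) for a simplicial v : Bd(K) -> K, because g v_#
   and the identity are homotopic by a homotopy carried by cones. The only
   exception are orientations for d = 0 with nonzero augmentation, for which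
   the degree is 1 since chain maps preserve the augmentation. *)

Require Import Defs.
From HB Require Import structures.
From mathcomp Require Import all_boot all_order all_algebra all_fingroup.
From mathcomp Require Import zify ring.

Set Implicit Arguments.
Unset Strict Implicit.
Unset Printing Implicit Defensive.

Import GRing.Theory.
Local Open Scope ring_scope.

(** * Linear extension and oriented simplices *)

(** The degree is computed on S instead of on its subdivision: as (g f)(g Z) = g((f g) Z), the map f
    g multiplies Z by the same integer as g f multiplies g Z, and exactness and strong connectedness
    are at hand on S. For the same reason cycles of the subdivision are pulled back to S; neither a
    pseudomanifold structure nor a vector field is ever built on a subdivision. Degrees are counted
    by vertices and the empty simplex generates degree 0. Every induction then starts at the empty
    simplex, where f g and the identity agree, and vertices need no separate treatment. Fillings
    provided by exactness are arbitrary choices and not equivariant; freeness allows them to be made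
    at one simplex of each orbit and translated along it. Signs are the other obstacle: simplices
    are stored with sorted vertices, which neither f nor the group respects. Maps are therefore
    evaluated on arbitrary vertex sequences by alternation, and where only a unit matters the sign
    is a power of -1 with unspecified exponent. The sign by which a group element acts on Z cancels
    at the end. *)

Definition lin (T T' : finType) (F : {set T} -> chain T') (c : chain T) :
    chain T' :=
  \sum_s F s *~ c s.

Lemma chainMzE (T : finType) n (x : chain T) t : (x *~ n) t = x t * n.
Proof.
by rewrite -mulrzz; case: n => n; rewrite ?NegzE /intmul ?ffunE ffunMnE.
Qed.

Section Lin.
Variables T T' : finType.

Lemma lin_is_zmod_morphism (F : {set T} -> chain T') :
  zmod_morphism (lin F).
Proof.
move=> c c'; rewrite /lin -sumrB; apply: eq_bigr => s _.
by rewrite ffunE ffunE mulrzBr.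
Qed.

HB.instance Definition _ (F : {set T} -> chain T') :=
  GRing.isZmodMorphism.Build (chain T) (chain T') (lin F)
    (lin_is_zmod_morphism F).

Lemma lin_simplex (F : {set T} -> chain T') s : lin F (simplex_chain s) = F s.
Proof.
rewrite /lin (bigD1 s) //= ffunE eqxx big1 ?addr0 // => t /negbTE ts.
by rewrite ffunE ts mulr0z.
Qed.

Lemma chain_sumE (c : chain T) : c = \sum_s simplex_chain s *~ c s.
Proof.
apply/ffunP=> t; rewrite sum_ffunE (bigD1 t) //= chainMzE ffunE eqxx mul1r.
rewrite big1 ?addr0 // => s /negbTE st.
by rewrite chainMzE ffunE eq_sym st mul0r.
Qed.

Lemma linE (F : {set T} -> chain T') c t : lin F c t = \sum_s F s t * c s.
Proof.
by rewrite sum_ffunE; apply: eq_bigr => s _; rewrite chainMzE.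
Qed.

Lemma eq_lin (F G : {set T} -> chain T') (c : chain T) :
  (forall s, c s != 0 -> F s = G s) -> lin F c = lin G c.
Proof.
move=> eqFG; apply: eq_bigr => s _.
by have [->|/eqFG->//] := eqVneq (c s) 0; rewrite !mulr0z.
Qed.

(** Only simplices in the support of [c] are tested. With [c] the boundary of a simplex, an
    induction on cardinality needs its hypothesis at facets only. *)
Lemma additive_eq_on (A B : {additive chain T -> chain T'}) (c : chain T) :
  (forall s, c s != 0 -> A (simplex_chain s) = B (simplex_chain s)) ->
  A c = B c.
Proof.
move=> eqAB; rewrite (chain_sumE c) !raddf_sum; apply: eq_bigr => s _.
by have [->|/eqAB e] := eqVneq (c s) 0; rewrite ?mulr0z ?raddf0 // !raddfMz e.
Qed.

Lemma chain_2torsionfree (x : chain T) : x = - x -> x = 0.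
Proof.
have int_2tf (n : int) : n = - n -> n = 0 by lia.
by move=> e; apply/ffunP=> t; rewrite ffunE; apply: int_2tf; rewrite {1}e ffunE.
Qed.

End Lin.

(** Chains carry no complex and [lin] sums over all sets; membership in a complex, or in a carrier,
    is tracked by this predicate. *)
Definition supp (T : finType) (P : pred {set T}) (c : chain T) : Prop :=
  forall s, c s != 0 -> P s.

Section Supp.
Variable T : finType.
Implicit Types (P Q : pred {set T}) (c : chain T).

Lemma supp0 P : supp P 0.
Proof. by move=> s; rewrite ffunE eqxx. Qed.

Lemma suppD P c c' : supp P c -> supp P c' -> supp P (c + c').
Proof.
move=> Pc Pc' s; rewrite ffunE; have [->|/Pc//] := eqVneq (c s) 0.
by rewrite add0r => /Pc'.
Qed.

Lemma suppN P c : supp P c -> supp P (- c).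
Proof. by move=> Pc s; rewrite ffunE oppr_eq0 => /Pc. Qed.

Lemma suppB P c c' : supp P c -> supp P c' -> supp P (c - c').
Proof. by move=> Pc Pc'; apply/suppD/suppN. Qed.

Lemma suppMz P c n : supp P c -> supp P (c *~ n).
Proof.
move=> Pc s; rewrite chainMzE => cn; apply: Pc; apply: contraNneq cn => ->.
by rewrite mul0r.
Qed.

Lemma supp_sum P (I : Type) (r : seq I) (R : pred I) (F : I -> chain T) :
  (forall i, R i -> supp P (F i)) -> supp P (\sum_(i <- r | R i) F i).
Proof.
move=> PF; apply: big_ind => //; [exact: supp0|exact: suppD].
Qed.

Lemma supp_simplex P s : P s -> supp P (simplex_chain s).
Proof. by move=> Ps t; rewrite ffunE; case: (t =P s) => [->|]. Qed.

Lemma supp_weaken P Q c : (forall s, P s -> Q s) -> supp P c -> supp Q c.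
Proof. by move=> PQ Pc s /Pc /PQ. Qed.

Lemma supp_pred0 c : supp pred0 c -> c = 0.
Proof. by move=> c0; apply/ffunP=> s; rewrite ffunE; apply/eqP/idPn => /c0. Qed.

End Supp.

Lemma supp_lin (T T' : finType) (P : pred {set T}) (Q : pred {set T'}) F c :
  supp P c -> (forall s, P s -> supp Q (F s)) -> supp Q (lin F c).
Proof.
move=> Pc QF; apply: supp_sum => s _; have [->|/Pc/QF] := eqVneq (c s) 0.
  by rewrite mulr0z; apply: supp0.
exact: suppMz.
Qed.

(** Adjacent transpositions suffice, as they generate all permutations. The case [a = b] is
    included; chains have no 2-torsion, so repeated entries force the value 0. *)
Definition alternating (T T' : finType) (F : seq T -> chain T') : Prop :=
  forall s1 a b s2, F (s1 ++ a :: b :: s2) = - F (s1 ++ b :: a :: s2).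

Section Alternating.
Variable T : finType.

Lemma alternating_behead (T' : finType) (F : seq T -> chain T') x :
  alternating F -> alternating (fun s => F (x :: s)).
Proof. by move=> altF s1 a b s2; apply: (altF (x :: s1)). Qed.

Lemma alternating_move (T' : finType) (F : seq T -> chain T') x s1 s2 :
  alternating F -> F (x :: s1 ++ s2) = F (s1 ++ x :: s2) *~ (-1) ^+ size s1.
Proof.
elim: s1 F => [|y s1 IH] F altF /=; first by rewrite mulr1z.
rewrite (altF [::]) /= (IH _ (alternating_behead y altF)) exprS mulN1r.
by rewrite mulrNz.
Qed.

(** The exponent comes before [F]: two alternating functions change by the same sign, which is thus
    never computed. *)
Lemma alternating_perm (s v : seq T) : perm_eq s v ->
  exists n : nat, forall (T' : finType) (F : seq T -> chain T'),
    alternating F -> F s = F v *~ (-1) ^+ n.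
Proof.
elim: s v => [|x s IH] v.
  by rewrite perm_sym => /perm_nilP->; exists 0%N => T' F _; rewrite mulr1z.
move=> pv; have xv: x \in v by rewrite -(perm_mem pv) mem_head.
case/splitPr: xv pv => v1 v2; rewrite perm_sym perm_catC /= perm_cons.
rewrite perm_catC perm_sym => /IH [n eqF].
exists (size v1 + n)%N => T' F altF.
rewrite (eqF _ _ (alternating_behead x altF)) alternating_move //.
by rewrite -mulrzA exprD.
Qed.

Lemma alternating_nuniq (T' : finType) (F : seq T -> chain T') s :
  alternating F -> ~~ uniq s -> F s = 0.
Proof.
move=> altF nus; have [x [s1 [p1]]] : exists x s1, perm_eq s [:: x, x & s1].
  elim: s nus => //= x s IH; rewrite negb_and negbK.
  have [xs _|_ /= /IH [y [s1 p]]] := boolP (x \in s).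
    exists x, (rem x s); rewrite perm_cons; exact: perm_to_rem.
  exists y, (x :: s1).
  rewrite -(perm_cons x) in p; apply: perm_trans p _.
  exact/permPl/(perm_catCA [:: x] [:: y; y] s1).
have [n eqF] := alternating_perm p1; rewrite (eqF _ _ altF).
by rewrite (@chain_2torsionfree _ (F [:: x, x & s1])) ?mul0rz // {1}(altF [::]).
Qed.

End Alternating.

(* Sealed, since conversion would otherwise unfold the sum over permutations. *)
HB.lock Definition osimplex (T : finType) (le : rel T) : seq T -> chain T :=
  @oriented T le.

Section Oriented.
Variables (T : finType) (le : rel T).
Hypothesis leP : total_order le.

Let le_tr : transitive le. Proof. by case: leP. Qed.
Let le_anti : antisymmetric le. Proof. by case: leP. Qed.
Let le_tot : total le. Proof. by case: leP. Qed.

Lemma perm_vseq s : perm_eq (vseq le s) (enum s).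
Proof. by rewrite perm_sort. Qed.

Lemma mem_vseq s : vseq le s =i s.
Proof. by move=> x; rewrite (perm_mem (perm_vseq s)) mem_enum. Qed.

Lemma size_vseq s : size (vseq le s) = #|s|.
Proof. by rewrite size_sort cardE. Qed.

Lemma vseq_uniq s : uniq (vseq le s).
Proof. by rewrite sort_uniq enum_uniq. Qed.

Lemma vseq_sorted s : sorted le (vseq le s).
Proof. exact: sort_sorted. Qed.

Lemma set_vseq s : [set x in vseq le s] = s.
Proof. by apply/setP=> x; rewrite inE mem_vseq. Qed.

Lemma sorted_vseq s : sorted le s -> uniq s -> vseq le [set x in s] = s.
Proof.
move=> ss us; apply: (sorted_eq le_tr le_anti) => //; first exact: vseq_sorted.
apply: uniq_perm => //; first exact: vseq_uniq.
by move=> x; rewrite mem_vseq inE.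
Qed.

Lemma vseq0 : vseq le set0 = [::].
Proof. by rewrite /vseq enum_set0. Qed.

(** This is [sort_sign] with the length as a parameter, so that rearranging the entries stays inside
    one symmetric group. *)
Definition sign_tuple n (t : n.-tuple T) : int :=
  \sum_(pi : 'S_n | sorted le [seq tnth t (pi i) | i : 'I_n]) (-1) ^+ pi.

Lemma sort_sign_tuple n (t : n.-tuple T) : sort_sign le t = sign_tuple t.
Proof.
case: t => s sz; move: (sz); move: (eqP sz) => e; subst n => sz' /=.
by rewrite /sort_sign; congr sign_tuple; apply: val_inj.
Qed.

Lemma sign_tuple_perm n (t : n.-tuple T) (sigma : 'S_n) :
  sign_tuple [tuple tnth t (sigma i) | i < n] = (-1) ^+ sigma * sign_tuple t.
Proof.
rewrite /sign_tuple mulr_sumr.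
rewrite (reindex_inj (mulIg (sigma^-1)%g)) /=.
apply: eq_big => [pi|pi _].
  congr (sorted le); apply: eq_map => i.
  by rewrite tnth_mktuple permM permKV.
by rewrite odd_permM odd_permV signr_addb mulrC.
Qed.

Lemma sort_sign_swap s1 a b s2 :
  sort_sign le (s1 ++ a :: b :: s2) = - sort_sign le (s1 ++ b :: a :: s2).
Proof.
set s := s1 ++ a :: b :: s2; set s' := s1 ++ b :: a :: s2.
have szs' : size s' == size s by rewrite !size_cat.
have lt1: (size s1 < size s)%N by rewrite size_cat /=; lia.
have lt2: ((size s1).+1 < size s)%N by rewrite size_cat /=; lia.
pose i := Ordinal lt1; pose j := Ordinal lt2.
have -> : s' = [tuple tnth (in_tuple s) (tperm i j k) | k < size s].
  apply: (@eq_from_nth _ a).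
    by rewrite size_tuple (eqP szs').
  move=> k; rewrite (eqP szs') => ltk.
  rewrite -[RHS](@tnth_nth _ _ _ _ (Ordinal ltk)) tnth_mktuple.
  rewrite (tnth_nth a) /=.
  case: tpermP => [/(congr1 val)/= ->|/(congr1 val)/= ->|].
  - by rewrite !nth_cat /= ltnn !subSnn ltnNge leqnSn /= subnn.
  - by rewrite !nth_cat /= ltnn !subSnn ltnNge leqnSn /= subnn.
  move=> ni nj; have {}ni : k != size s1 by apply: contra_not_neq ni => ?; apply: val_inj.
  have {}nj : k != (size s1).+1 by apply: contra_not_neq nj => ?; apply: val_inj.
  rewrite !nth_cat /=; have [//|ge1] := ltnP k (size s1).
  have: (k - size s1 > 1)%N by lia.
  by case: (k - size s1)%N => [|[|m]].
rewrite sort_sign_tuple sign_tuple_perm odd_tperm.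
have -> : (i != j) by rewrite -val_eqE /=; lia.
by rewrite expr1 mulN1r opprK.
Qed.

Lemma osimplex_alternating : alternating (osimplex le).
Proof.
move=> s1 a b s2; rewrite osimplex.unlock /oriented.
have p : perm_eq (s1 ++ a :: b :: s2) (s1 ++ b :: a :: s2).
  by rewrite perm_cat2l (perm_catCA [:: a] [:: b] s2).
rewrite (perm_uniq p); case: ifP => _; last by rewrite oppr0.
have -> : [set x in s1 ++ a :: b :: s2] = [set x in s1 ++ b :: a :: s2].
  by apply/setP=> x; rewrite !inE (perm_mem p).
by rewrite sort_sign_swap mulrNz.
Qed.

Lemma sort_sign_sorted s : uniq s -> sorted le s -> sort_sign le s = 1.
Proof.
move=> us ss; rewrite /sort_sign (bigD1 1%g) /=; last first.
  rewrite (_ : [seq _ | i : _] = s) //.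
  rewrite -[RHS](map_tnth_enum (in_tuple s)).
  by apply: eq_image => // i; rewrite perm1.
rewrite odd_perm1 big1 ?addr0 // => pi /andP[spi /negP[]].
apply/eqP/permP=> i; rewrite perm1.
have e : [seq tnth (in_tuple s) (pi i) | i : 'I_(size s)] = s.
  apply: (sorted_eq le_tr le_anti) => //.
  have -> : [seq tnth (in_tuple s) (pi i) | i : 'I_(size s)] =
     [tuple tnth (in_tuple s) (pi i) | i < size s] by [].
  rewrite perm_sym; apply/tuple_permP; exists (pi^-1)%g.
  rewrite -[LHS](map_tnth_enum (in_tuple s)).
  by apply: eq_image => // k /=; rewrite tnth_mktuple permKV.
have := congr1 (nth (tnth (in_tuple s) i) ^~ i) e.
rewrite (nth_map i) ?size_enum_ord // nth_ord_enum (tnth_nth (tnth (in_tuple s) i)) /=.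
move/eqP; rewrite nth_uniq // => /eqP; exact: val_inj.
Qed.

Lemma osimplex_vseq s : osimplex le (vseq le s) = simplex_chain s.
Proof.
rewrite osimplex.unlock /oriented vseq_uniq set_vseq.
by rewrite sort_sign_sorted ?vseq_uniq ?vseq_sorted.
Qed.

Lemma osimplex_nuniq s : ~~ uniq s -> osimplex le s = 0.
Proof. by rewrite osimplex.unlock /oriented => /negbTE->. Qed.

(** Sorting [s] changes [F] and [osimplex] by the same sign, and both vanish on repetitions. So a
    map defined on sorted vertices may be evaluated on any sequence. *)
Lemma lin_osimplex (T' : finType) (F : seq T -> chain T') s :
  alternating F -> lin (fun t => F (vseq le t)) (osimplex le s) = F s.
Proof.
move=> altF; have [us|nus] := boolP (uniq s); last first.
  by rewrite (alternating_nuniq altF) // osimplex_nuniq // raddf0.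
have p : perm_eq s (vseq le [set x in s]).
  by apply: uniq_perm => //; [exact: vseq_uniq | move=> x; rewrite mem_vseq inE].
have [n eqF] := alternating_perm p; rewrite (eqF _ _ altF).
by rewrite (eqF _ _ osimplex_alternating) raddfMz /= osimplex_vseq lin_simplex.
Qed.

Lemma osimplex_uniq s : uniq s ->
  exists n : nat, osimplex le s = simplex_chain [set x in s] *~ (-1) ^+ n.
Proof.
move=> us; have p : perm_eq s (vseq le [set x in s]).
  by apply: uniq_perm => //; [exact: vseq_uniq | move=> x; rewrite mem_vseq inE].
have [n eqF] := alternating_perm p; exists n.
by rewrite (eqF _ _ osimplex_alternating) osimplex_vseq.
Qed.

Lemma osimplex_nil : osimplex le [::] = simplex_chain set0.
Proof. by rewrite -vseq0 osimplex_vseq. Qed.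

Lemma supp_osimplex (P : pred {set T}) s :
  (uniq s -> P [set x in s]) -> supp P (osimplex le s).
Proof.
have [us Ps|/osimplex_nuniq-> _] := boolP (uniq s); last exact: supp0.
by have [n ->] := osimplex_uniq us; apply/suppMz/supp_simplex/Ps.
Qed.

Lemma additive_osimplex_eq (T' : finType) (A B : {additive chain T -> chain T'}) :
  (forall s, uniq s -> A (osimplex le s) = B (osimplex le s)) -> A =1 B.
Proof.
move=> eqAB c; apply: additive_eq_on => s _; rewrite -osimplex_vseq.
exact/eqAB/vseq_uniq.
Qed.

End Oriented.

(** * The augmented boundary and induced chain maps *)

Section Cone.
Variables (T : finType) (le : rel T).

Definition vjoin (v : T) : chain T -> chain T :=
  lin (fun t => osimplex le (v :: vseq le t)).

HB.instance Definition _ v := GRing.Additive.on (vjoin v).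

Lemma cone_vjoin v c : cone le v c = vjoin v c.
Proof. by apply: eq_bigr => t _; rewrite osimplex.unlock. Qed.

(* Augmented: the boundary of the vertex {x} is the empty simplex. *)
Fixpoint seq_boundary (s : seq T) : chain T :=
  if s is x :: s' then osimplex le s' - vjoin x (seq_boundary s') else 0.

Definition aug_boundary : chain T -> chain T :=
  lin (fun t => seq_boundary (vseq le t)).

HB.instance Definition _ := GRing.Additive.on aug_boundary.

Hypothesis leP : total_order le.

Lemma vjoin_osimplex v s : vjoin v (osimplex le s) = osimplex le (v :: s).
Proof.
apply: (lin_osimplex leP (F := fun s => osimplex le (v :: s))).
exact/alternating_behead/osimplex_alternating.
Qed.

Lemma vjoin_anticomm a b c : vjoin a (vjoin b c) = - vjoin b (vjoin a c).
Proof.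
rewrite -[RHS]/((-%R \o (vjoin b \o vjoin a)) c).
apply: (additive_osimplex_eq leP (A := vjoin a \o vjoin b)) => s _ /=.
by rewrite !vjoin_osimplex (osimplex_alternating le [::]).
Qed.

(** Exchanging the two leading vertices swaps the two terms that drop one of them, which carry
    opposite signs, and negates the remaining double cone by anticommutation. *)
Lemma seq_boundary_alternating : alternating seq_boundary.
Proof.
move=> s1 a b s2; elim: s1 => [|x s1 IH] /=.
  rewrite !raddfB /= !vjoin_osimplex.
  by rewrite !opprK addrCA vjoin_anticomm.
by rewrite IH (osimplex_alternating le) raddfN opprD.
Qed.

Lemma aug_boundary_osimplex s : aug_boundary (osimplex le s) = seq_boundary s.
Proof. exact/(lin_osimplex leP)/seq_boundary_alternating. Qed.

(** No condition on [v] is imposed: if [v] is a vertex of a simplex, its cone is 0 and the right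
    side cancels too. In particular the cone over a cycle bounds that cycle, which drives all the
    constructions by cones. *)
Lemma aug_boundary_vjoin v c :
  aug_boundary (vjoin v c) = c - vjoin v (aug_boundary c).
Proof.
rewrite -[RHS]/((idfun \- (vjoin v \o aug_boundary)) c).
apply: (additive_osimplex_eq leP (A := aug_boundary \o vjoin v)) => s _ /=.
by rewrite vjoin_osimplex !aug_boundary_osimplex.
Qed.

Lemma aug_boundaryK c : aug_boundary (aug_boundary c) = 0.
Proof.
rewrite -[RHS]/(\0 c).
apply: (additive_osimplex_eq leP (A := aug_boundary \o aug_boundary)) => s _ /=.
rewrite aug_boundary_osimplex; elim: s => /= [|x s IH]; first by rewrite raddf0.
by rewrite raddfB /= aug_boundary_vjoin IH raddf0 subr0 aug_boundary_osimplex subrr.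
Qed.

Lemma aug_boundary0 : aug_boundary (simplex_chain set0) = 0.
Proof. by rewrite -(osimplex_nil leP) aug_boundary_osimplex. Qed.

Lemma osimplex1 x : osimplex le [:: x] = simplex_chain [set x].
Proof.
rewrite -(osimplex_vseq leP); congr osimplex; apply/esym/perm_small_eq => //.
by apply: uniq_perm => //; [exact: vseq_uniq | move=> y; rewrite mem_vseq !inE].
Qed.

Lemma aug_boundary_set1 x : aug_boundary (simplex_chain [set x]) = simplex_chain set0.
Proof.
by rewrite -osimplex1 aug_boundary_osimplex /= raddf0 subr0 osimplex_nil.
Qed.

Lemma seq_boundaryE s : seq_boundary s =
  \sum_(i < size s) osimplex le (take i s ++ drop i.+1 s) *~ (-1) ^+ i.
Proof.
elim: s => [|x s IH] /=; first by rewrite big_ord0.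
rewrite big_ord_recl /= drop0 mulr1z IH (raddf_sum (vjoin x)) -sumrN; congr (_ + _).
apply: eq_bigr => i _; rewrite raddfMz /= vjoin_osimplex.
by rewrite exprS mulN1r mulrNz.
Qed.

Lemma aug_boundary_simplex s : aug_boundary (simplex_chain s) =
  \sum_(i < size (vseq le s))
    simplex_chain (s :\ tnth (in_tuple (vseq le s)) i) *~ (-1) ^+ i.
Proof.
rewrite [LHS]lin_simplex seq_boundaryE; apply: eq_bigr => i _; congr (_ *~ _).
set v := vseq le s; pose x := tnth (in_tuple v) i.
have ev : v = take i v ++ x :: drop i.+1 v.
  rewrite -{1}(cat_take_drop i v) (drop_nth x (ltn_ord i)).
  by rewrite -(tnth_nth x (in_tuple v)).
have uv : uniq v := vseq_uniq le s.
have xNv : x \notin take i v ++ drop i.+1 v.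
  have: perm_eq v (x :: take i v ++ drop i.+1 v).
    rewrite {1}ev; exact/permPl/(perm_catCA (take i v) [:: x] (drop i.+1 v)).
  by move/perm_uniq; rewrite uv /= => /esym/andP[].
have sub : subseq (take i v ++ drop i.+1 v) v.
  by rewrite {3}ev; apply: cat_subseq; rewrite // subseq_cons.
have -> : s :\ x = [set y in take i v ++ drop i.+1 v].
  apply/setP=> y; rewrite !inE -(mem_vseq le) -/v.
  have [->|yx] := eqVneq y x; first by rewrite (negbTE xNv).
  by rewrite {1}ev !mem_cat inE (negbTE yx).
rewrite -(osimplex_vseq leP) (sorted_vseq leP) ?(subseq_uniq sub) //.
apply: (subseq_sorted _ sub); first by case: leP.
exact: vseq_sorted.
Qed.

Lemma supp_aug_boundary_simplex s :
  supp (fun t => is_facet t s) (aug_boundary (simplex_chain s)).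
Proof.
rewrite aug_boundary_simplex; apply: supp_sum => i _; apply/suppMz/supp_simplex.
have xs : tnth (in_tuple (vseq le s)) i \in s by rewrite -(mem_vseq le) mem_tnth.
by rewrite /is_facet subsetDl (cardsD1 (tnth (in_tuple (vseq le s)) i) s) xs
  add1n eqxx.
Qed.

Lemma simplex_vjoinE (v : T) (t : {set T}) : v \notin t ->
  exists n : nat, simplex_chain (v |: t) = vjoin v (simplex_chain t) *~ (-1) ^+ n.
Proof.
move=> vt; rewrite -[simplex_chain t](osimplex_vseq leP) vjoin_osimplex.
have u : uniq (v :: vseq le t) by rewrite /= mem_vseq vt vseq_uniq.
have [n ->] := osimplex_uniq leP u; exists n.
rewrite -mulrzA -exprD addnn -mul2n exprM sqrrN !expr1n mulr1z.
by congr simplex_chain; apply/setP=> x; rewrite !inE mem_vseq.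
Qed.

Lemma vjoinE (v : T) (c : chain T) (A : {set T}) : exists n : nat,
  vjoin v c A = if v \in A then c (A :\ v) * (-1) ^+ n else 0.
Proof.
rewrite /vjoin linE; have [vA|vA] := boolP (v \in A); last first.
  exists 0%N; apply: big1 => t _; apply/eqP; rewrite mulf_eq0; apply/orP; left.
  apply: contraNT vA => /(@supp_osimplex _ _ leP (fun B => v \in B)); apply => _.
  by rewrite inE mem_head.
have vA' : v \notin A :\ v by rewrite !inE eqxx.
have u : uniq (v :: vseq le (A :\ v)) by rewrite /= mem_vseq vA' vseq_uniq.
have [n eqn] := osimplex_uniq leP u; exists n.
rewrite (bigD1 (A :\ v)) //= big1 ?addr0; last first.
  move=> t tA; apply/eqP; rewrite mulf_eq0; apply/orP; left.
  apply: contraNT tA => /(@supp_osimplex _ _ leP (fun B => t == B :\ v)); apply.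
  rewrite /= mem_vseq => /andP[vt _]; apply/eqP/setP=> x.
  by rewrite !inE mem_vseq; have [->|] := eqVneq; rewrite ?(negbTE vt).
rewrite eqn chainMzE ffunE (_ : A == _ = true) ?mul1r 1?mulrC //.
by apply/eqP/setP=> x; rewrite !inE mem_vseq !inE; have [->|] := eqVneq.
Qed.

(** Up to sign [s] is the cone over [t] from the missing vertex [x]; its boundary is [t] minus a
    chain whose simplices all contain [x]. *)
Lemma aug_boundary_facet (s t : {set T}) : is_facet t s ->
  exists n : nat, aug_boundary (simplex_chain s) t = (-1) ^+ n.
Proof.
case/andP=> ts /eqP cs.
have [x xs xt] : exists2 x, x \in s & x \notin t.
  by apply/subsetPn; apply/negP=> /subset_leq_card; rewrite cs ltnn.
have -> : s = x |: t.
  apply/esym/eqP; rewrite eqEcard subUset sub1set xs ts cardsU1 xt cs /=.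
  by rewrite add1n.
have [n ->] := simplex_vjoinE xt; exists n.
rewrite raddfMz /= aug_boundary_vjoin chainMzE !ffunE eqxx.
have [m ->] := vjoinE x (aug_boundary (simplex_chain t)) t.
by rewrite (negbTE xt) subr0 mul1r.
Qed.

Lemma aug_boundary_nfacet (s t : {set T}) : ~~ is_facet t s ->
  aug_boundary (simplex_chain s) t = 0.
Proof. by apply: contraNeq; apply: supp_aug_boundary_simplex. Qed.

Lemma incidence_aug_boundary s t :
  incidence le s t = aug_boundary (simplex_chain s) t.
Proof.
rewrite aug_boundary_simplex sum_ffunE /incidence big_mkcond /=.
apply: eq_bigr => i _; rewrite chainMzE ffunE.
by case: eqP => _; rewrite ?mul1r ?mul0r.
Qed.

End Cone.
Arguments supp_aug_boundary_simplex {T le} leP s.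

Lemma closed_facet (T : finType) (K : {set {set T}}) (s t : {set T}) :
  is_complex K -> s \in K -> is_facet t s -> t \in K.
Proof. by case=> _ Kcl sK /andP[ts _]; apply: Kcl ts. Qed.

Lemma supp_aug_boundary (T : finType) (le : rel T) (K : {set {set T}}) n
    (c : chain T) :
  total_order le -> is_complex K -> supp (mem (faces K n.+1)) c ->
  supp (mem (faces K n)) (aug_boundary le c).
Proof.
move=> leP Kc Kn; apply: (supp_lin Kn) => s; rewrite /= inE => /andP[sK /eqP cs].
rewrite -[seq_boundary _ _](lin_simplex (fun t => seq_boundary le (vseq le t))).
apply: supp_weaken _ (supp_aug_boundary_simplex leP s) => t ft.
rewrite /= inE (closed_facet Kc sK ft) /=.
by case/andP: ft => _; rewrite cs eqSS eq_sym.
Qed.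

Lemma sum_supp (T T' : finType) (D : {set {set T}}) (F : {set T} -> chain T')
    (c : chain T) :
  supp (mem D) c -> \sum_(s in D) F s *~ c s = lin F c.
Proof.
move=> Dc; rewrite big_mkcond; apply: eq_bigr => s _; case: ifP => // sD.
by have [->|/Dc] := eqVneq (c s) 0; rewrite ?mulr0z //= sD.
Qed.

(** Positive dimensions only: on 0-chains [boundary] is zero while [aug_boundary] is the
    augmentation. This difference makes [d = 0] a separate case at the end. *)
Lemma boundaryE (T : finType) (le : rel T) (K : {set {set T}}) q
    (c : chain T) :
  total_order le -> is_complex K -> supp (mem (faces K q.+2)) c ->
  boundary K le q.+1 c = aug_boundary le c.
Proof.
move=> leP Kc Kn; rewrite /boundary sum_supp //; apply: eq_lin => s /Kn.
rewrite /= => sK; rewrite -[RHS](lin_simplex (fun t => seq_boundary le (vseq le t))).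
rewrite -/(aug_boundary le _) [RHS]chain_sumE -[RHS]/(lin _ _)
  -(@sum_supp _ _ (faces K q.+1)).
  by apply: eq_bigr => t _; rewrite incidence_aug_boundary.
by apply: (supp_aug_boundary leP Kc); apply: supp_simplex.
Qed.

(** * Chain maps induced by vertex maps *)

Section Push.
Variables (T1 T2 : finType) (le1 : rel T1) (le2 : rel T2).

Definition push (f : T1 -> T2) : chain T1 -> chain T2 :=
  lin (fun t => osimplex le2 (map f (vseq le1 t))).

HB.instance Definition _ f := GRing.Additive.on (push f).

Lemma map_chainE (K : {set {set T1}}) f q (c : chain T1) : supp (mem (faces K q.+1)) c ->
  map_chain K le1 le2 f q c = push f c.
Proof.
by move=> cK; rewrite /map_chain sum_supp // /push osimplex.unlock.
Qed.

Hypotheses (leP1 : total_order le1) (leP2 : total_order le2).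
Variable f : T1 -> T2.

Lemma push_osimplex s : push f (osimplex le1 s) = osimplex le2 (map f s).
Proof.
apply: (lin_osimplex leP1 (F := fun s => osimplex le2 (map f s))).
by move=> s1 a b s2; rewrite !map_cat /= (osimplex_alternating le2).
Qed.

Lemma push_vjoin v c : push f (vjoin le1 v c) = vjoin le2 (f v) (push f c).
Proof.
rewrite -[RHS]/((vjoin le2 (f v) \o push f) c).
apply: (additive_osimplex_eq leP1 (A := push f \o vjoin le1 v)) => s _ /=.
by rewrite vjoin_osimplex // !push_osimplex vjoin_osimplex.
Qed.

Lemma push_aug_boundary c :
  push f (aug_boundary le1 c) = aug_boundary le2 (push f c).
Proof.
rewrite -[RHS]/((aug_boundary le2 \o push f) c).
apply: (additive_osimplex_eq leP1 (A := push f \o aug_boundary le1)) => s _ /=.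
rewrite push_osimplex !aug_boundary_osimplex //.
elim: s => /= [|x s IH]; first by rewrite raddf0.
by rewrite raddfB /= push_vjoin IH push_osimplex.
Qed.

Lemma push_set0 : push f (simplex_chain set0) = simplex_chain set0.
Proof. by rewrite -(osimplex_nil leP1) push_osimplex /= osimplex_nil. Qed.

Lemma supp_push_simplex (s : {set T1}) :
  supp (fun t => (t == f @: s) && (#|t| == #|s|)) (push f (simplex_chain s)).
Proof.
rewrite -(osimplex_vseq leP1) push_osimplex; apply: (supp_osimplex leP2) => u.
have E : [set x in [seq f i | i <- vseq le1 s]] = f @: s.
  apply/setP=> y; rewrite inE; apply/mapP/imsetP => -[x xs ->]; exists x => //.
    by rewrite -(mem_vseq le1).
  by rewrite mem_vseq.
by rewrite {1}E eqxx cardsE (card_uniqP u) size_map size_vseq /=.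
Qed.

Arguments supp_push_simplex : clear implicits.

Lemma supp_push (K1 : {set {set T1}}) (K2 : {set {set T2}}) n
    (c : chain T1) :
  simplicial_map K1 K2 f -> supp (mem (faces K1 n)) c ->
  supp (mem (faces K2 n)) (push f c).
Proof.
move=> fK cK; apply: (supp_lin cK) => s /=; rewrite inE => /andP[sK /eqP <-].
rewrite -[osimplex _ _](lin_simplex (fun t => osimplex le2 (map f (vseq le1 t)))).
apply: supp_weaken _ (supp_push_simplex s) => t /andP[/eqP et /eqP ct].
by rewrite /= inE ct eqxx andbT et fK.
Qed.

Lemma push_simplex_inj (s : {set T1}) : {in s &, injective f} ->
  exists n : nat, push f (simplex_chain s) = simplex_chain (f @: s) *~ (-1) ^+ n.
Proof.
move=> injf; rewrite -(osimplex_vseq leP1) push_osimplex.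
have u : uniq (map f (vseq le1 s)).
  by rewrite map_inj_in_uniq ?vseq_uniq // => x y; rewrite !mem_vseq; apply: injf.
have [n ->] := osimplex_uniq leP2 u; exists n; congr (simplex_chain _ *~ _).
apply/setP=> y; rewrite inE; apply/mapP/imsetP => -[x xs ->]; exists x => //.
  by rewrite -(mem_vseq le1).
by rewrite mem_vseq.
Qed.

Lemma eq_in_push (g : T1 -> T2) (c : chain T1) :
  (forall s, c s != 0 -> {in s, f =1 g}) -> push f c = push g c.
Proof.
move=> efg; apply: eq_lin => s /efg e; congr (osimplex le2 _).
by apply/eq_in_map => x; rewrite mem_vseq; apply: e.
Qed.

End Push.
Arguments supp_push_simplex {T1 T2 le1 le2} leP1 leP2 f s.

Lemma push_comp (T1 T2 T3 : finType) (le1 : rel T1) (le2 : rel T2) (le3 : rel T3)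
    (f : T1 -> T2) (g : T2 -> T3) c :
  total_order le1 -> total_order le2 -> total_order le3 ->
  push le2 le3 g (push le1 le2 f c) = push le1 le3 (g \o f) c.
Proof.
move=> leP1 leP2 leP3; rewrite -[LHS]/((push le2 le3 g \o push le1 le2 f) c).
apply: (additive_osimplex_eq leP1 (B := push le1 le3 (g \o f))) => s _ /=.
by rewrite !push_osimplex // map_comp.
Qed.

Lemma push_id (T : finType) (le : rel T) (f : T -> T) c :
  total_order le -> f =1 id -> push le le f c = c.
Proof.
move=> leP f1; rewrite -[RHS]/(idfun c).
apply: (additive_osimplex_eq leP (A := push le le f)) => s _ /=.
by rewrite push_osimplex // (eq_map f1) map_id.
Qed.

(** * Barycentric subdivision *)

Lemma supp_vjoin (T : finType) (le : rel T) (P Q : pred {set T}) v c :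
  total_order le -> supp P c -> (forall t, P t -> v \notin t -> Q (v |: t)) ->
  supp Q (vjoin le v c).
Proof.
move=> leP Pc PQ A; have [n ->] := vjoinE leP v c A.
case: ifP => [vA|]; last by rewrite eqxx.
move=> nz; rewrite -(setD1K vA); apply: PQ; last by rewrite !inE eqxx.
by apply: Pc; apply: contraNneq nz => ->; rewrite mul0r.
Qed.

Section Flags.
Variable T : finType.
Implicit Types (K : {set {set T}}) (A B : {set {set T}}) (s t : {set T}).

Definition flag A : bool :=
  [forall s in A, forall t in A, (s \subset t) || (t \subset s)].

Lemma flagP A :
  reflect {in A &, forall s t, (s \subset t) || (t \subset s)} (flag A).
Proof.
apply: (iffP forall_inP) => [fl s t sA tA|fl s sA].
  exact: (forall_inP (fl s sA)).
by apply/forall_inP=> t tA; apply: fl.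
Qed.

(** Pairwise comparability replaces the sorted tuple. Conversely, sorting by cardinality gives
    strict inclusions, since comparable sets are included in order of size and the members are
    distinct. *)
Lemma in_Bd K A : (A \in Bd K) = (A \subset K :\ set0) && flag A.
Proof.
rewrite inE; congr (_ && _); apply/existsP/flagP => [[w /andP[sw /eqP ->]] s t|fl].
  rewrite !inE => sw' tw'.
  have pr_tr : transitive (fun a b : {set T} => a \proper b).
    by move=> a b c; apply: proper_trans.
  have [->|st] := eqVneq s t; first by rewrite subxx.
  have /orP : (index s w < index t w)%N || (index t w < index s w)%N.
    rewrite -neq_ltn; apply: contra_neq st => e.
    by rewrite -(nth_index set0 sw') e nth_index.
  case=> lt; apply/orP; [left|right]; apply: proper_sub.
    by have /= := sorted_ltn_index pr_tr sw s t sw' tw' lt.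
  by have /= := sorted_ltn_index pr_tr sw t s tw' sw' lt.
pose lec (a b : {set T}) := (#|a| <= #|b|)%N.
have szw : size (sort lec (enum A)) == #|A| by rewrite size_sort cardE.
exists (Tuple szw) => /=.
have eA : A = [set x in sort lec (enum A)].
  by apply/setP=> x; rewrite inE mem_sort mem_enum.
rewrite -eA eqxx andbT.
have : sorted lec (sort lec (enum A)) by apply: sort_sorted => a b; apply: leq_total.
have : uniq (sort lec (enum A)) by rewrite sort_uniq enum_uniq.
have : {subset sort lec (enum A) <= A} by move=> x; rewrite mem_sort mem_enum.
elim: (sort lec (enum A)) => [|a [|b s] IH] //= sub /and3P[/=].
rewrite inE negb_or => /andP[ab _] bs us /andP[leab pb].
apply/andP; split; last first.
  by apply: IH; rewrite /= ?bs // => x xs; apply: sub; rewrite inE xs orbT.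
have aA : a \in A by apply: sub; rewrite mem_head.
have bA : b \in A by apply: sub; rewrite !inE eqxx orbT.
rewrite properEneq ab /=; have /orP[//|ba] := fl a b aA bA.
by have /eqP-> : b == a by rewrite eqEcard ba.
Qed.

Lemma Bd_subset K K' : K \subset K' -> Bd K \subset Bd K'.
Proof.
move=> KK'; apply/subsetP=> A; rewrite !in_Bd => /andP[AK ->].
by rewrite (subset_trans AK) // setSD.
Qed.

Lemma flagS A B : B \subset A -> flag A -> flag B.
Proof.
move=> /subsetP BA /flagP fA; apply/flagP=> s t sB tB.
by apply: fA; apply: BA.
Qed.

Lemma flag0 : flag set0.
Proof. by apply/flagP=> s t; rewrite inE. Qed.

Lemma set0_in_Bd K : set0 \in Bd K.
Proof. by rewrite in_Bd sub0set flag0. Qed.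

Lemma Bd_complex K : is_complex (Bd K).
Proof.
split=> [|A B]; first by apply/set0Pn; exists set0; apply: set0_in_Bd.
rewrite !in_Bd => /andP[AK fA] BA.
by rewrite (subset_trans BA AK) (flagS BA).
Qed.

(** The member of largest cardinality contains all others, so [cover A] is the top element of the
    flag; it is used in this sense throughout. *)
Lemma cover_flag A : flag A -> A != set0 -> cover A \in A.
Proof.
move=> /flagP fA /set0Pn[s0 s0A].
case: (@arg_maxnP _ s0 (mem A) (fun s => #|s|) s0A) => s sA max.
suff -> : cover A = s by [].
apply/eqP; rewrite eqEsubset; apply/andP; split; last exact: bigcup_sup.
apply/bigcupsP=> t tA; have /orP[st|//] := fA s t sA tA.
have /eqP-> // : s == t by rewrite eqEcard st; apply: max.
Qed.

(** The members have distinct cardinalities, all between 1 and that of the union. *)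
Lemma card_flag A : flag A -> set0 \notin A -> (#|A| <= #|cover A|)%N.
Proof.
move=> /flagP fA A0; pose szs := [seq #|pred_of_set s| | s <- enum A].
have -> : #|A| = size szs by rewrite size_map cardE.
rewrite -(size_iota 1 #|cover A|); apply: uniq_leq_size.
  rewrite map_inj_in_uniq ?enum_uniq // => s t; rewrite !mem_enum => sA tA e.
  apply/eqP; have /orP[st|ts] := fA s t sA tA.
    by rewrite eqEcard st e leqnn.
  by rewrite eq_sym eqEcard ts e leqnn.
move=> n /mapP[s]; rewrite mem_enum => sA ->; rewrite mem_iota.
rewrite card_gt0 add1n ltnS subset_leq_card ?(bigcup_sup s) // andbT.
by apply: contraNneq A0 => <-.
Qed.

Lemma Bd_set0 K A : A \in Bd K -> set0 \notin A.
Proof.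
rewrite in_Bd => /andP[/subsetP AK _]; apply/negP=> /AK.
by rewrite !inE eqxx.
Qed.

Lemma Bd_flag K A : A \in Bd K -> flag A.
Proof. by rewrite in_Bd => /andP[]. Qed.

Lemma cover_Bd K A : A \in Bd K -> A != set0 -> cover A \in K /\ cover A != set0.
Proof.
rewrite in_Bd => /andP[/subsetP AK fA] A0.
by have := AK _ (cover_flag fA A0); rewrite !inE => /andP[].
Qed.

Lemma card_Bd K N A : is_complex K -> (forall s, s \in K -> (#|s| <= N)%N) ->
  A \in Bd K -> (#|A| <= N)%N.
Proof.
move=> Kc KN AK; have [->|A0] := eqVneq A set0; first by rewrite cards0.
apply: leq_trans (card_flag (Bd_flag AK) (Bd_set0 AK)) _.
by apply: KN; have [] := cover_Bd AK A0.
Qed.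

Lemma Bd_powerset_cover K A : A \in Bd K -> A \in Bd (powerset (cover A)).
Proof.
move=> AK; rewrite in_Bd (Bd_flag AK) andbT; apply/subsetP=> s sA.
rewrite !inE bigcup_sup // andbT; apply: contraNneq (Bd_set0 AK) => <- //.
Qed.

(** [Bd (powerset s)] is the subdivided full simplex, a cone with apex [s]; it serves as the carrier
    of chains attached to [s]. *)
Lemma Bd_powerset_setU1 s A : s != set0 -> A \in Bd (powerset s) ->
  s |: A \in Bd (powerset s).
Proof.
move=> s0; rewrite !in_Bd => /andP[/subsetP As /flagP fA].
have sub t : t \in s |: A -> (t != set0) && (t \subset s).
  by rewrite in_setU1 => /predU1P[->|/As]; rewrite ?s0 ?subxx // !inE.
apply/andP; split; first by apply/subsetP=> t /sub; rewrite !inE.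
apply/flagP=> t u tA uA; have /andP[_ ts] := sub t tA; have /andP[_ us] := sub u uA.
move: tA uA; rewrite !in_setU1 => /predU1P[->|tA]; first by rewrite us orbT.
by case/predU1P=> [->|uA]; [rewrite ts | apply: fA].
Qed.

Lemma Bd_powerset_sub s t : s \subset t -> Bd (powerset s) \subset Bd (powerset t).
Proof. by move=> st; apply: Bd_subset; rewrite powersetS. Qed.

End Flags.

(** * The subdivision chain map *)

Section Subdivision.
Variables (T : finType) (le : rel T) (le' : rel {set T}).

(** The number [n] is fuel, meant to be the cardinality of [s]. Starting at the empty simplex makes
    the value at a vertex an instance of the cone formula. *)
Fixpoint subdivn (n : nat) (s : {set T}) : chain {set T} :=
  if n is m.+1 then
    vjoin le' s (lin (subdivn m) (aug_boundary le (simplex_chain s)))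
  else simplex_chain set0.

Definition subdiv : chain T -> chain {set T} := lin (fun s => subdivn #|s| s).

HB.instance Definition _ := GRing.Additive.on subdiv.

Hypotheses (leP : total_order le) (leP' : total_order le').

Lemma subdiv_set0 : subdiv (simplex_chain set0) = simplex_chain set0.
Proof. by rewrite /subdiv lin_simplex cards0. Qed.

Lemma subdiv_simplex s : s != set0 -> subdiv (simplex_chain s) =
  vjoin le' s (subdiv (aug_boundary le (simplex_chain s))).
Proof.
rewrite -card_gt0 => s0; rewrite {1}/subdiv lin_simplex.
case cs: #|s| s0 => [//|m] _ /=; congr (vjoin le' s _).
apply: eq_lin => t /(supp_aug_boundary_simplex leP) /andP[_].
by rewrite cs eqSS => /eqP ->.
Qed.

(** By the cone formula the error is the cone over the boundary of the subdivided boundary, which by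
    induction on facets is the subdivision of a double boundary, hence 0. *)
Lemma aug_boundary_subdiv c :
  aug_boundary le' (subdiv c) = subdiv (aug_boundary le c).
Proof.
apply: (additive_eq_on (A := aug_boundary le' \o subdiv)
   (B := subdiv \o aug_boundary le)) => s _ /=.
have [n] := ubnP #|s|; elim: n s => // n IH s lts.
have [->|s0] := eqVneq s set0.
  by rewrite subdiv_set0 !aug_boundary0 // raddf0.
rewrite subdiv_simplex // aug_boundary_vjoin // -[RHS]subr0; congr (_ - _).
suff -> : aug_boundary le' (subdiv (aug_boundary le (simplex_chain s))) =
          subdiv (aug_boundary le (aug_boundary le (simplex_chain s))).
  by rewrite aug_boundaryK // !raddf0.
apply: (additive_eq_on (A := aug_boundary le' \o subdiv)
   (B := subdiv \o aug_boundary le)) => t /(supp_aug_boundary_simplex leP) ft /=.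
by apply: IH; case/andP: ft => _ /eqP ct; rewrite ct ltnS in lts.
Qed.

Lemma supp_subdiv_simplex s :
  supp (fun A => (A \in Bd (powerset s)) && (#|A| == #|s|))
    (subdiv (simplex_chain s)).
Proof.
have [n] := ubnP #|s|; elim: n s => // n IH s lts.
have [->|s0] := eqVneq s set0.
  by rewrite subdiv_set0; apply: supp_simplex; rewrite set0_in_Bd !cards0.
rewrite subdiv_simplex //.
apply: (@supp_vjoin _ _
  (fun A => (A \in Bd (powerset s)) && (#|A|.+1 == #|s|)) _ _ _ leP'); last first.
  by move=> A /andP[As /eqP cA] sA; rewrite Bd_powerset_setU1 // cardsU1 sA add1n cA /=.
apply: supp_lin (supp_aug_boundary_simplex leP s) _ => t /andP[ts /eqP cs].
rewrite -[subdivn _ _](lin_simplex (fun s => subdivn #|s| s)).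
have ltt : (#|t| < n)%N by rewrite cs ltnS in lts.
apply: supp_weaken _ (IH t ltt) => A /andP[At /eqP->].
by rewrite (subsetP (Bd_powerset_sub ts)) //= cs.
Qed.
Arguments supp_subdiv_simplex : clear implicits.

Lemma supp_subdiv (K : {set {set T}}) n (c : chain T) :
  is_complex K -> supp (mem (faces K n)) c ->
  supp (mem (faces (Bd K) n)) (subdiv c).
Proof.
move=> [_ Kcl] cK; apply: (supp_lin cK) => s /=; rewrite inE => /andP[sK /eqP <-].
rewrite -[subdivn _ _](lin_simplex (fun s => subdivn #|s| s)).
apply: supp_weaken _ (supp_subdiv_simplex s) => A /= /andP[As cA].
rewrite inE cA andbT; apply: subsetP As; apply: Bd_subset.
by apply/subsetP=> t; rewrite inE; apply: Kcl.
Qed.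

(** Removing the top [s] from a flag with as many members as [s] has elements leaves such a flag for
    a single facet of [s], its own union. So each level of the recursion contributes one sign and
    nothing is added up. *)
Lemma subdiv_simplex_coef (s : {set T}) (A : {set {set T}}) :
  flag A -> set0 \notin A -> #|A| = #|s| ->
  exists n : nat,
    subdiv (simplex_chain s) A = if cover A == s then (-1) ^+ n else 0.
Proof.
have [m] := ubnP #|s|; elim: m s A => // m IH s A lts fA A0 cA.
have [s0|s0] := eqVneq s set0.
  exists 0%N; move: cA; rewrite s0 cards0 => /cards0_eq ->.
  by rewrite subdiv_set0 ffunE eqxx /cover big_set0 eqxx.
have nA : A != set0 by rewrite -card_gt0 cA card_gt0.
have cAA := cover_flag fA nA.
rewrite subdiv_simplex //.
have [k ->] := vjoinE leP' s (subdiv (aug_boundary le (simplex_chain s))) A.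
have [sA|sA] := boolP (s \in A); last first.
  by exists 0%N; case: eqP => // e; rewrite -e cAA in sA.
have fB : flag (A :\ s) by apply: flagS fA; apply: subsetDl.
have B0 : set0 \notin A :\ s by apply: contra A0 => /setD1P[].
have cB : #|s| = #|A :\ s|.+1 by rewrite -cA (cardsD1 s) sA.
have coefB t : is_facet t s -> exists n : nat,
    subdiv (simplex_chain t) (A :\ s) = if cover (A :\ s) == t then (-1) ^+ n else 0.
  case/andP=> _ /eqP ct; rewrite ct in lts; apply: IH => //.
  by move: cB; rewrite ct => -[].
rewrite /subdiv linE.
have zero t : t != cover (A :\ s) ->
    subdivn #|t| t (A :\ s) * aug_boundary le (simplex_chain s) t = 0.
  move=> tA; have [ft|nft] := boolP (is_facet t s); last first.
    by rewrite aug_boundary_nfacet // mulr0.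
  rewrite -[subdivn _ _](lin_simplex (fun s => subdivn #|s| s)).
  have [n ->] := coefB t ft.
  by rewrite eq_sym (negbTE tA) mul0r.
rewrite (bigD1 (cover (A :\ s))) //= big1 ?addr0 //.
have [fct|nfct] := boolP (is_facet (cover (A :\ s)) s); last first.
  rewrite aug_boundary_nfacet // mulr0 mul0r; exists 0%N; case: eqP => // eAs.
  (* If the top is [s], the rest is a flag of #|s| - 1 nonempty sets. Its union has at least that
     many elements and is properly contained in [s], so it is a facet after all. *)
  case/negP: nfct; have sub : cover (A :\ s) \subset s.
    rewrite -{2}eAs; apply/bigcupsP=> t /setD1P[_ tA]; exact: bigcup_sup.
  rewrite /is_facet sub cB eqSS eqn_leq card_flag //=.
  have [B0'|Bn0] := eqVneq (A :\ s) set0; first by rewrite B0' /cover big_set0 cards0.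
  have /setD1P[neq _] := cover_flag fB Bn0.
  rewrite -ltnS -cB; apply: proper_card; rewrite properEneq neq; exact: sub.
rewrite -[subdivn _ _](lin_simplex (fun s => subdivn #|s| s)).
have [n ->] := coefB _ fct; rewrite eqxx.
have [l ->] := aug_boundary_facet leP fct.
exists (n + l + k)%N; rewrite -!exprD.
suff -> : cover A == s by [].
rewrite eqEsubset (bigcup_sup s) // andbT; apply/bigcupsP=> t tA.
have [->//|ts] := eqVneq t s; case/andP: fct => sub _.
by apply: subset_trans sub; apply: bigcup_sup; rewrite !inE ts.
Qed.

Lemma subdiv_coef n (c : chain T) (A : {set {set T}}) :
  supp (fun s => #|s| == n) c -> flag A -> set0 \notin A -> #|A| = n ->
  exists k : nat, subdiv c A = (-1) ^+ k * c (cover A).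
Proof.
move=> cn fA A0 cA; rewrite /subdiv linE (bigD1 (cover A)) //= big1 ?addr0.
  have [c0|/cn/eqP cn'] := eqVneq (c (cover A)) 0.
    by exists 0%N; rewrite c0 !mulr0.
  rewrite -[subdivn _ _](lin_simplex (fun s => subdivn #|s| s)).
  have [|k] := @subdiv_simplex_coef (cover A) A fA A0; first by rewrite cA cn'.
  by rewrite /subdiv eqxx => ->; exists k.
move=> s sA; have [->|/cn/eqP cn'] := eqVneq (c s) 0; first by rewrite mulr0.
rewrite -[subdivn _ _](lin_simplex (fun s => subdivn #|s| s)).
have [|k] := @subdiv_simplex_coef s A fA A0; first by rewrite cA cn'.
by rewrite /subdiv eq_sym (negbTE sA) => ->; rewrite mul0r.
Qed.

Lemma subdiv_chainE (K : {set {set T}}) q (c : chain T) :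
  is_complex K -> supp (mem (faces K q.+1)) c ->
  subdiv_chain K le le' q c = subdiv c.
Proof.
move=> Kc; elim: q c => [|q IH] c cK /=.
  rewrite sum_supp //; apply: eq_lin => s /cK /=.
  rewrite inE => /andP[_ cs]; have /cards1P[x ->] := cs.
  rewrite -[RHS](lin_simplex (fun s => subdivn #|s| s)) -/(subdiv _).
  rewrite subdiv_simplex -?card_gt0 ?cards1 //.
  rewrite aug_boundary_set1 // subdiv_set0 -(osimplex_nil leP').
  by rewrite vjoin_osimplex // osimplex1.
rewrite sum_supp //; apply: eq_lin => s /cK /= sK.
rewrite -[RHS](lin_simplex (fun s => subdivn #|s| s)) -/(subdiv _).
have s0 : s != set0 by move: sK; rewrite inE -card_gt0 => /andP[_ /eqP->].
have sK' : supp (mem (faces K q.+2)) (simplex_chain s) by apply: supp_simplex.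
rewrite subdiv_simplex // cone_vjoin; congr (vjoin le' s _).
by rewrite -/(boundary K le q.+1 _) boundaryE // IH //; apply: supp_aug_boundary.
Qed.

End Subdivision.
Arguments supp_subdiv_simplex {T le le'} leP leP' s.

(** * Top cycles of a subdivision *)

(** For injective [f] no simplex degenerates and the apex [s] goes to the apex [f @: s], so the
    recursive cone formulas match. It is applied to group elements. *)
Lemma subdiv_push (T1 T2 : finType) (le1 : rel T1) (le1' : rel {set T1})
    (le2 : rel T2) (le2' : rel {set T2}) (f : T1 -> T2) c :
  total_order le1 -> total_order le1' -> total_order le2 -> total_order le2' ->
  injective f ->
  push le1' le2' (fun A : {set T1} => f @: A) (subdiv le1 le1' c) =
  subdiv le2 le2' (push le1 le2 f c).
Proof.
move=> leP1 leP1' leP2 leP2' injf; set fs := fun A : {set T1} => f @: A.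
pose F : {additive chain T1 -> chain {set T2}} := push le1' le2' fs \o subdiv le1 le1'.
pose G : {additive chain T1 -> chain {set T2}} := subdiv le2 le2' \o push le1 le2 f.
rewrite -[LHS]/(F c) -[RHS]/(G c); apply: additive_eq_on => s _.
have [n] := ubnP #|s|; elim: n s => // n IH s lts.
have [->|s0] := eqVneq s set0.
  by rewrite /F /G /= subdiv_set0 !push_set0 // subdiv_set0.
rewrite /F /G /= subdiv_simplex // push_vjoin //.
have bdE : push le1' le2' fs (subdiv le1 le1' (aug_boundary le1 (simplex_chain s))) =
           subdiv le2 le2' (push le1 le2 f (aug_boundary le1 (simplex_chain s))).
  rewrite -[LHS]/(F _) -[RHS]/(G _); apply: additive_eq_on => t.
  move=> /(supp_aug_boundary_simplex leP1) /andP[_ /eqP ct].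
  by apply: IH; rewrite ct ltnS in lts.
rewrite bdE push_aug_boundary //.
have [k ->] := push_simplex_inj leP1 leP2 (in2W injf) (s := s).
rewrite !raddfMz /= [in RHS]subdiv_simplex //.
by apply: contraNneq s0 => e; rewrite -(imset_eq0 f) -/(fs s) /fs e.
Qed.

(** * The homotopy between the identity and subdivision after a vertex choice *)

Section Carrier.
Variables (T : finType) (le : rel T) (le' : rel {set T}).
Hypotheses (leP : total_order le) (leP' : total_order le').
Variable v : {set T} -> T.
Hypothesis v_in : forall s, s != set0 -> v s \in s.

Let psi (c : chain {set T}) : chain {set T} := subdiv le le' (push le' le v c).

Let psi_zmod_morphism : zmod_morphism psi.
Proof. by move=> c c'; rewrite /psi !raddfB. Qed.

HB.instance Definition _ :=
  GRing.isZmodMorphism.Build _ _ psi psi_zmod_morphism.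

(* Cones over the top element of the flag, which spans an acyclic carrier. *)
Fixpoint carrier_homotopyn (n : nat) (A : {set {set T}}) : chain {set T} :=
  if n is m.+1 then
    vjoin le' (cover A) (psi (simplex_chain A) - simplex_chain A -
      lin (carrier_homotopyn m) (aug_boundary le' (simplex_chain A)))
  else 0.

Definition carrier_homotopy : chain {set T} -> chain {set T} :=
  lin (fun A => carrier_homotopyn #|A| A).

HB.instance Definition _ := GRing.Additive.on carrier_homotopy.

Lemma carrier_homotopy_simplex A : A != set0 ->
  carrier_homotopy (simplex_chain A) =
  vjoin le' (cover A) (psi (simplex_chain A) - simplex_chain A -
    carrier_homotopy (aug_boundary le' (simplex_chain A))).
Proof.
rewrite -card_gt0 => A0; rewrite {1}/carrier_homotopy lin_simplex.
case cA: #|A| A0 => [//|m] _ /=; congr (vjoin le' _ (_ - _)).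
apply: eq_lin => t /(supp_aug_boundary_simplex leP') /andP[_].
by rewrite cA eqSS => /eqP ->.
Qed.

(** The chain being coned is a cycle, by this very identity on the facets of [A]; hence the boundary
    of its cone gives it back. *)
Lemma carrier_homotopyE c :
  aug_boundary le' (carrier_homotopy c) + carrier_homotopy (aug_boundary le' c) =
  psi c - c.
Proof.
pose F : {additive chain {set T} -> chain {set T}} :=
  (aug_boundary le' \o carrier_homotopy) \+ (carrier_homotopy \o aug_boundary le').
pose G : {additive chain {set T} -> chain {set T}} := psi \- idfun.
rewrite -[LHS]/(F c) -[RHS]/(G c); apply: additive_eq_on => A _.
have [n] := ubnP #|A|; elim: n A => // n IH A ltA.
have [->|A0] := eqVneq A set0.
  rewrite /F /G /= aug_boundary0 // /psi push_set0 // subdiv_set0 subrr.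
  by rewrite /carrier_homotopy lin_simplex cards0 /= !raddf0 addr0.
rewrite /F /G /= carrier_homotopy_simplex // aug_boundary_vjoin //.
set c1 := aug_boundary le' (simplex_chain A).
have bdE : F c1 = G c1.
  apply: additive_eq_on => t /(supp_aug_boundary_simplex leP') /andP[_ /eqP ct].
  by apply: IH; rewrite ct ltnS in ltA.
have -> : aug_boundary le' (psi (simplex_chain A) - simplex_chain A -
    carrier_homotopy c1) = 0.
  rewrite !(raddfB (aug_boundary le')) /= /psi aug_boundary_subdiv //.
  rewrite -push_aug_boundary // -/c1 -/(psi c1) -[_ - c1]/(G c1) -bdE.
  by rewrite /F /= aug_boundaryK // raddf0 addr0 subrr.
by rewrite raddf0 subr0 subrK.
Qed.

Lemma supp_carrier_homotopy_simplex A :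
  flag A -> set0 \notin A -> A != set0 ->
  supp (fun B => (B \in Bd (powerset (cover A))) && (#|B| == #|A|.+1))
    (carrier_homotopy (simplex_chain A)).
Proof.
have [n] := ubnP #|A|; elim: n A => // n IH A ltA fA A0 nA.
have cA0 : cover A != set0.
  by apply: contraNneq A0 => <-; apply: cover_flag.
have ABd : A \in Bd (powerset (cover A)).
  apply: (@Bd_powerset_cover _ (powerset (cover A))).
  rewrite in_Bd fA andbT; apply/subsetP=> s sA; rewrite !inE bigcup_sup // andbT.
  by apply: contraNneq A0 => <-.
rewrite carrier_homotopy_simplex //.
apply: (@supp_vjoin _ _
  (fun B => (B \in Bd (powerset (cover A))) && (#|B| == #|A|)) _ _ _ leP');
  last first.
  by move=> B /andP[BA /eqP cB] vB; rewrite Bd_powerset_setU1 // cardsU1 vB add1n cB /=.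
apply: suppB; first apply: suppB.
- apply: (supp_lin (supp_push_simplex leP' leP v A)) => t /andP[/eqP et /eqP ct].
  rewrite -[subdivn _ _ _ _](lin_simplex (fun s => subdivn le le' #|s| s)).
  apply: supp_weaken _ (supp_subdiv_simplex leP leP' t) => B /andP[Bt].
  rewrite ct => ->; rewrite andbT; apply: subsetP Bt; apply: Bd_powerset_sub.
  rewrite et; apply/subsetP=> _ /imsetP[s sA ->]; apply/bigcupP; exists s => //.
  by apply: v_in; apply: contraNneq A0 => <-.
- by apply: supp_simplex; rewrite ABd eqxx.
apply: (supp_lin (supp_aug_boundary_simplex leP' A)) => A' /andP[A'A /eqP cA].
rewrite -[carrier_homotopyn _ _](lin_simplex (fun A => carrier_homotopyn #|A| A)).
have [->|nA'] := eqVneq A' set0.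
  by rewrite lin_simplex cards0; apply: supp0.
have ltA' : (#|A'| < n)%N by rewrite cA ltnS in ltA.
have A'0 : set0 \notin A' by apply: contra A0; apply: subsetP.
apply: supp_weaken _ (IH A' ltA' (flagS A'A fA) A'0 nA') => B /andP[BA' /eqP->].
rewrite cA eqxx andbT; apply: subsetP BA'; apply: Bd_powerset_sub.
by apply/bigcupsP=> s sA'; apply: bigcup_sup; apply: (subsetP A'A).
Qed.

(** The homotopy applied to [z] would live on flags with [N + 1] members, and there are none. So it
    vanishes, and the two ends of the homotopy agree on the cycle [z]. *)
Lemma subdiv_top_cycle (K : {set {set T}}) N (z : chain {set T}) :
  is_complex K -> (forall s, s \in K -> (#|s| <= N)%N) -> (0 < N)%N ->
  supp (mem (faces (Bd K) N)) z -> aug_boundary le' z = 0 ->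
  subdiv le le' (push le' le v z) = z.
Proof.
move=> Kc KN N0 zK z0; have := carrier_homotopyE z.
rewrite z0 raddf0 addr0 (supp_pred0 (c := carrier_homotopy z)) ?raddf0.
  by move/esym/eqP; rewrite subr_eq0 => /eqP.
apply: (supp_lin zK) => A /=; rewrite inE => /andP[AK /eqP cA].
rewrite -[carrier_homotopyn _ _](lin_simplex (fun A => carrier_homotopyn #|A| A)).
have nA : A != set0 by rewrite -card_gt0 cA.
apply: supp_weaken _ (supp_carrier_homotopy_simplex (Bd_flag AK) (Bd_set0 AK) nA).
move=> B /andP[BA /eqP cB] /=.
have BK : B \in Bd K.
  apply: subsetP BA; apply: Bd_subset; apply/subsetP=> s; rewrite inE => sA.
  by have [KA _] := cover_Bd AK nA; case: Kc => _ /(_ _ _ KA sA).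
by have := card_Bd Kc KN BK; rewrite cB cA ltnn.
Qed.

End Carrier.

Lemma simplicial_map_top (T : finType) (K : {set {set T}}) (v : {set T} -> T) :
  is_complex K -> (forall s, s != set0 -> v s \in s) ->
  simplicial_map (Bd K) K v.
Proof.
move=> [Kn Kcl] vP A AK; have [->|nA] := eqVneq A set0.
  rewrite imset0; have /set0Pn[s sK] := Kn.
  by apply: Kcl sK _; apply: sub0set.
have [cK _] := cover_Bd AK nA; apply: Kcl cK _.
apply/subsetP=> _ /imsetP[s sA ->]; apply/bigcupP; exists s => //.
by apply: vP; apply: contraNneq (Bd_set0 AK) => <-.
Qed.

(** * Exactness from a gradient vector field *)

Section AcyclicRelation.
Variables (X : finType) (R : rel X).
Hypothesis acyclic : forall x y, R x y -> ~~ connect R y x.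

(** The number of reachable points is a measure for induction along an acyclic relation;
    [card_ancestors] serves inductions in the opposite direction. *)
Lemma card_descendants x y :
  R x y -> (#|connect R y| < #|connect R x|)%N.
Proof.
move=> xy; apply: proper_card; apply/properP; split.
  by apply/subsetP=> z; apply: connect_trans; apply: connect1.
by exists x; [apply: connect0 | apply: acyclic].
Qed.

Lemma card_ancestors x y :
  R x y -> (#|[pred z | connect R z x]| < #|[pred z | connect R z y]|)%N.
Proof.
move=> xy; apply: proper_card; apply/properP; split.
  by apply/subsetP=> z; rewrite !inE => /connect_trans; apply; apply: connect1.
by exists y; rewrite !inE ?connect0 ?acyclic.
Qed.

End AcyclicRelation.

Section GradientExactness.
Variables (T : finType) (le : rel T) (K : {set {set T}}).
Variable V : {set {set T} * {set T}}.
Hypotheses (leP : total_order le) (Kc : is_complex K).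
Hypothesis gradV : gradient_vector_field K V.

Local Notation bd := (aug_boundary le).

Let V_facet a b : (a, b) \in V -> [/\ a \in K, b \in K & is_facet a b].
Proof. by case: gradV => -[Vf _] _ /Vf. Qed.

Let V_head a a' b : (a, b) \in V -> (a', b) \in V -> a = a'.
Proof.
case: gradV => -[_ Vu] _ abV abV'.
have := Vu b _ _ abV abV'; rewrite !inE /= eqxx !orbT => /(_ isT isT).
by case.
Qed.

(** One step of a trajectory with the intermediate face hidden, so that the absence of closed
    trajectories becomes acyclicity of a relation. *)
Definition head_step n : rel {set T} := fun b b' =>
  [&& b \in faces K n.+1, b' \in faces K n.+1, b != b'
    & [exists a in faces K n, ((a, b') \in V) && (a \proper b)]].

Lemma path_trajectory n b p : b \in faces K n.+1 -> path (head_step n) b p ->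
  exists2 w, trajectory K V n b w & unzip2 w = p.
Proof.
elim: p b => [|b' p IH] b bK /=; first by exists [::]; rewrite //= bK.
case/andP=> /and4P[_ b'K bb' /exists_inP[a aK /andP[abV ab]]] /(IH _ b'K)[w tw <-].
by exists ((a, b') :: w); rewrite //= bK aK abV ab bb'.
Qed.

Lemma head_step_acyclic n b b' :
  head_step n b b' -> ~~ connect (head_step n) b' b.
Proof.
move=> st; apply/negP=> /connectP[p pp eb].
have bK : b \in faces K n.+1 by case/and4P: st.
have [|[//|e w] tw ew] := @path_trajectory n b (b' :: p) bK; first by rewrite /= st.
case: gradV => _ /(_ _ _ _ tw isT) /negP[].
by rewrite ew /= -eb.
Qed.

Definition heads n : {set {set T}} :=
  [set s in faces K n | [exists a, (a, s) \in V]].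
(** These are the heads together with the unpaired simplices. *)
Definition nontails n : {set {set T}} :=
  [set s in faces K n | [forall b, (s, b) \notin V]].

(** A tail [a] paired with [b] can be traded, modulo the boundary of [b], for the other facets of
    [b]. Those that are tails again are paired with a successor of [b] under [head_step], so the
    trading ends. *)
Lemma eliminate_tails n (c : chain T) : supp (mem (faces K n)) c ->
  exists2 b, supp (mem (heads n.+1)) b & supp (mem (nontails n)) (c - bd b).
Proof.
pose Q (c : chain T) :=
  exists2 b, supp (mem (heads n.+1)) b & supp (mem (nontails n)) (c - bd b).
have Q0 : Q 0.
  by exists 0; [exact: supp0|rewrite raddf0 subr0; exact: supp0].
have QD (c1 c2 : chain T) : Q c1 -> Q c2 -> Q (c1 + c2).
  case=> b1 s1 t1 [b2 s2 t2]; exists (b1 + b2); first exact: suppD.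
  by rewrite raddfD /= opprD addrACA; apply: suppD.
have QM (c1 : chain T) k : Q c1 -> Q (c1 *~ k).
  case=> b1 s1 t1; exists (b1 *~ k); first exact: suppMz.
  by rewrite raddfMz /= -mulrzBl; apply: suppMz.
have Qsum (c1 : chain T) : (forall s, c1 s != 0 -> Q (simplex_chain s)) -> Q c1.
  move=> Qs; rewrite [c1]chain_sumE; apply: (big_ind Q) => //.
  move=> s _; have [->|/Qs Qs'] := eqVneq (c1 s) 0; last exact: QM.
  by rewrite mulr0z.
have Qnt s : s \in nontails n -> Q (simplex_chain s).
  move=> sN; exists 0; first exact: supp0.
  by rewrite raddf0 subr0; apply: supp_simplex.
suff Qtail a b : a \in faces K n -> (a, b) \in V -> Q (simplex_chain a).
  move=> cK; apply: Qsum => s /cK /= sK.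
  have [/Qnt//|] := boolP (s \in nontails n).
  by rewrite inE sK /= negb_forall => /existsP[b]; rewrite negbK; apply: Qtail.
have [m] := ubnP #|connect (head_step n) b|.
elim: m a b => // m IH a b ltb aK abV.
have [_ bK fab] := V_facet abV.
have ca : #|a| = n by move: aK; rewrite inE => /andP[_ /eqP].
have cb : #|b| = n.+1 by case/andP: fab => _ /eqP->; rewrite ca.
have bF : b \in faces K n.+1 by rewrite inE bK cb eqxx.
have [k ek] := aug_boundary_facet leP fab.
pose c1 := bd (simplex_chain b) - simplex_chain a *~ (-1) ^+ k.
have Qc1 : Q c1.
  apply: Qsum => t; rewrite /c1 ffunE ffunE chainMzE ffunE.
  have [->|ta] := eqVneq t a; first by rewrite ek mul1r subrr eqxx.
  rewrite mul0r subr0 => /(supp_aug_boundary_simplex leP) ft.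
  have tF : t \in faces K n.
    rewrite inE (closed_facet Kc bK ft) /=.
    by case/andP: ft => _; rewrite cb eqSS eq_sym.
  have [/Qnt//|] := boolP (t \in nontails n).
  rewrite inE tF /= negb_forall => /existsP[b']; rewrite negbK => tbV.
  have [_ b'K ft'] := V_facet tbV.
  have ct : #|t| = n by move: tF; rewrite inE => /andP[_ /eqP].
  have st : head_step n b b'.
    apply/and4P; split=> //.
    - by rewrite inE b'K /=; case/andP: ft' => _ /eqP->; rewrite ct.
    - apply: contraNneq ta => ebb; rewrite -ebb in tbV.
      by apply/eqP; apply: V_head tbV abV.
    apply/exists_inP; exists t => //; rewrite tbV properEcard cb ct ltnSn andbT.
    by case/andP: ft.
  apply: (IH t b') => //.
  by apply: leq_trans (card_descendants (@head_step_acyclic n) st) _; rewrite -ltnS.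
have -> : simplex_chain a = (bd (simplex_chain b) - c1) *~ (-1) ^+ k.
  rewrite /c1 opprB addrC subrK -mulrzA -exprD addnn -mul2n exprM sqrrN !expr1n.
  by rewrite mulr1z.
apply: (QM); apply: (QD); last by rewrite -[- c1]mulrN1z; apply: (QM).
exists (simplex_chain b); last by rewrite subrr; apply: supp0.
by apply: supp_simplex => /=; rewrite inE bF /=; apply/existsP; exists a.
Qed.

(** Let the head [b] be paired with [a]. Any other head of the chain containing [a] is a predecessor
    of [b], so by induction its coefficient is 0; the coefficient of the boundary at [a] is then
    that of [b] up to sign. *)
Lemma heads_cycle n (c : chain T) : supp (mem (heads n.+1)) c -> bd c = 0 -> c = 0.
Proof.
move=> cH c0; apply/ffunP=> b; rewrite ffunE.
have [m] := ubnP #|[pred z | connect (head_step n) z b]|.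
elim: m b => // m IH b ltb.
have [//|cb] := eqVneq (c b) 0.
have := cH _ cb; rewrite /= inE => /andP[bF /existsP[a abV]].
have [aK bK fab] := V_facet abV.
have [k ek] := aug_boundary_facet leP fab.
have := congr1 (fun x : chain T => x a) c0; rewrite ffunE /aug_boundary linE.
rewrite (bigD1 b) //= big1 ?addr0.
  rewrite -[seq_boundary _ _](lin_simplex (fun t => seq_boundary le (vseq le t))).
  by rewrite -/(aug_boundary le _) ek => /eqP; rewrite mulf_eq0 signr_eq0 => /eqP.
move=> s sb.
rewrite -[seq_boundary _ _](lin_simplex (fun t => seq_boundary le (vseq le t))).
rewrite -/(aug_boundary le _).
have [fas|nf] := boolP (is_facet a s); last by rewrite aug_boundary_nfacet // mul0r.
have [->|cs] := eqVneq (c s) 0; first by rewrite mulr0.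
rewrite IH ?mulr0 //.
have := cH _ cs; rewrite /= inE => /andP[sF _].
have ca : #|a| = n.
  by move: bF; rewrite inE => /andP[_]; case/andP: fab => _ /eqP->; rewrite eqSS => /eqP.
have st : head_step n s b.
  apply/and4P; split=> //; apply/exists_inP; exists a.
    by rewrite inE aK ca /=.
  rewrite abV properEcard; case/andP: fas => -> /eqP->.
  by rewrite ltnSn.
by apply: leq_trans (card_ancestors (@head_step_acyclic n) st) _; rewrite -ltnS.
Qed.

Variables (d : nat) (s0 t0 : {set T}).
Hypothesis critV : critical K V = [set s0; t0].
Hypotheses (s0t0 : s0 != t0) (card_s0 : #|s0| = d.+1) (card_t0 : #|t0| = 1%N).

Lemma critical_cell s : s \in critical K V -> #|s| != d.+1 -> s = t0.
Proof.
by rewrite critV !inE => /orP[]/eqP -> //; rewrite card_s0 eqxx.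
Qed.

Lemma s0_K : s0 \in K.
Proof.
have : s0 \in critical K V by rewrite critV !inE eqxx.
by rewrite inE => /andP[].
Qed.

Lemma t0_K : t0 \in K.
Proof.
have : t0 \in critical K V by rewrite critV !inE eqxx orbT.
by rewrite inE => /andP[].
Qed.

(* Since b avoids the critical cell s0, the cycle s0 - b is nonzero for
   bd b = bd s0. *)
Lemma sphere_exact n (c : chain T) : (n <= d)%N -> supp (mem (faces K n)) c -> bd c = 0 ->
  exists b, [/\ supp (mem (faces K n.+1)) b, b s0 = 0 & bd b = c].
Proof.
have bdt0 : bd (simplex_chain t0) = simplex_chain set0.
  by have /eqP/cards1P[x ->] := card_t0; rewrite aug_boundary_set1.
case: n => [|n] nd cK c0.
  exists (simplex_chain t0 *~ c set0); split.
  - by apply/suppMz/supp_simplex; rewrite /= inE t0_K card_t0.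
  - by rewrite chainMzE ffunE (negbTE s0t0) mul0r.
  rewrite raddfMz /= bdt0; apply/ffunP=> s; rewrite chainMzE ffunE.
  have [->|s_n0] := eqVneq s set0; first by rewrite mul1r.
  rewrite mul0r; apply/esym/eqP; apply: contraNT s_n0 => /cK /=.
  by rewrite inE cards_eq0 => /andP[].
have [b bH cb] := eliminate_tails cK.
exists b; split.
- by apply: supp_weaken _ bH => s /=; rewrite inE => /andP[].
(* In this branch [d] is positive, so the critical cell [s0] is unpaired and cannot be a head; hence
   [b] avoids it. *)
- apply/eqP; apply: contraT => /bH /=; rewrite !inE card_s0 => /andP[_ /existsP[a aV]].
  have : s0 \in critical K V by rewrite critV !inE eqxx.
  rewrite inE card_s0 => /and3P[_ _]; rewrite eqSS.
  have -> : (d == 0%N) = false by apply/negbTE; rewrite -lt0n; apply: leq_trans nd.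
  rewrite andFb orbF => /forall_inP/(_ _ aV).
  by rewrite !inE eqxx orbT.
have bdc : bd (c - bd b) = 0.
  by rewrite raddfB /= aug_boundaryK // subr0.
suff : c - bd b = 0 by move/eqP; rewrite subr_eq0 => /eqP.
(* An unpaired simplex is critical, and [s0] has too many vertices, which leaves [t0]. *)
have dich s : s \in nontails n.+1 -> (s \in heads n.+1) || (s == t0).
  rewrite inE => /andP[sF /forallP snt]; rewrite inE sF /=.
  move: (sF); rewrite inE => /andP[sK /eqP cs].
  have [sc|] := boolP (s \in critical K V).
    by rewrite (critical_cell sc) ?eqxx ?orbT // cs eqSS neq_ltn nd.
  rewrite inE sK -card_gt0 cs /= negb_or => /andP[+ _].
  rewrite negb_forall_in => /exists_inP[[a a'] aV]; rewrite negbK !inE /=.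
  case/orP=> /eqP es; first by have := snt a'; rewrite es aV.
  by apply/orP; left; apply/existsP; exists a; rewrite es.
case: n nd cK cb bdc bH dich => [|n] nd cK cb bdc bH dich; last first.
  apply: (@heads_cycle n.+1) => // s /cb /= sN.
  case/orP: (dich s sN) => // /eqP es.
  by move: sN; rewrite !inE es card_t0 andbF.
(* On vertices a head is paired with the empty simplex and therefore counts as critical, so it is
   [t0] as well. What remains is a multiple of [t0], and its augmentation is 0. *)
have only_t0 s : s \in nontails 1 -> s = t0.
  move=> sN; case/orP: (dich s sN) => [|/eqP//].
  rewrite inE => /andP[sF /existsP[a aV]].
  move: (sF); rewrite inE => /andP[sK /eqP cs].
  have [_ _ /andP[_]] := V_facet aV; rewrite cs eqSS eq_sym cards_eq0 => /eqP a0.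
  apply: critical_cell; last by rewrite cs eqSS neq_ltn nd.
  by rewrite inE sK -card_gt0 cs /= -a0 aV orbT.
have e : c - bd b = simplex_chain t0 *~ (c - bd b) t0.
  apply/ffunP=> s; rewrite chainMzE [simplex_chain _ _]ffunE.
  have [->|st] := eqVneq s t0; first by rewrite mul1r.
  by rewrite mul0r; apply/eqP; apply: contraNT st => /cb/only_t0 ->.
move: bdc; rewrite e raddfMz /= bdt0 => /(congr1 (fun x : chain T => x set0)).
by rewrite chainMzE !ffunE eqxx mul1r => ->; rewrite mulr0z.
Qed.

Lemma top_cycle_exists : exists Z : chain T,
  [/\ supp (mem (faces K d.+1)) Z, bd Z = 0 & Z s0 = 1].
Proof.
have s0F : supp (mem (faces K d.+1)) (simplex_chain s0).
  by apply: supp_simplex; rewrite /= inE s0_K card_s0 eqxx.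
have [||b [bK b0 eb]] := @sphere_exact d (bd (simplex_chain s0)) (leqnn d).
- exact: supp_aug_boundary.
- exact: aug_boundaryK.
exists (simplex_chain s0 - b); split; first exact: suppB.
  by rewrite raddfB /= eb subrr.
by rewrite !ffunE eqxx b0 subr0.
Qed.

End GradientExactness.

(** * Top-dimensional cycles of a pseudomanifold *)

Section TopCycles.
Variables (T : finType) (le : rel T) (d : nat) (K : {set {set T}}).
Hypotheses (leP : total_order le) (Kpm : pseudomanifold d K).

Lemma pseudomanifold_card s : s \in K -> (#|s| <= d.+1)%N.
Proof.
case: Kpm => _ Kmax _ _ sK.
have [t] := maxset_exists (P := mem K) sK; move=> tm st.
by rewrite -(Kmax t tm); apply: subset_leq_card.
Qed.

(** Only [a] and [b] contain their common facet, so the boundary of [z] there is a signed sum of two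
    coefficients. *)
Lemma cycle_adjacent (z : chain T) a b : supp (mem (faces K d.+1)) z ->
  aug_boundary le z = 0 -> adjacent K d a b ->
  exists n : nat, z b = (-1) ^+ n * z a.
Proof.
move=> zK z0 /and3P[aF bF abF].
have [<-|ab] := eqVneq a b; first by exists 0%N; rewrite mul1r.
case: Kpm => _ _ two _.
have eab : [set s in faces K d.+1 | a :&: b \subset s] = [set a; b].
  apply/esym/eqP; rewrite eqEcard cards2 ab (two _ abF) leqnn andbT.
  apply/subsetP=> s; rewrite in_set2 => /orP[]/eqP->.
    by rewrite inE aF subsetIl.
  by rewrite inE bF subsetIr.
have facet s : s \in faces K d.+1 -> a :&: b \subset s -> is_facet (a :&: b) s.
  move: abF; rewrite !inE => /andP[_ /eqP cab] /andP[_ /eqP cs] sub.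
  by rewrite /is_facet sub cab cs /=.
have [k ek] := aug_boundary_facet leP (facet a aF (subsetIl _ _)).
have [l el] := aug_boundary_facet leP (facet b bF (subsetIr _ _)).
have := congr1 (fun x : chain T => x (a :&: b)) z0.
rewrite ffunE /aug_boundary linE.
pose G s := aug_boundary le (simplex_chain s) (a :&: b) * z s.
rewrite (eq_bigr G) => [|s _]; last first.
  by rewrite /G /aug_boundary lin_simplex.
rewrite (bigD1 a) //= (bigD1 b) 1?eq_sym //= big1 => [|s /andP[sa sb]].
  rewrite /G ek el addr0 => /eqP; rewrite addr_eq0 => /eqP e.
  exists (l + k).+1; rewrite exprS exprD -!mulrA e !mulrN mulN1r opprK mulrA.
  by rewrite -exprD addnn -mul2n exprM sqrrN !expr1n mul1r.
rewrite /G; have [->|/zK /= sF] := eqVneq (z s) 0; first by rewrite mulr0.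
rewrite aug_boundary_nfacet ?mul0r //; apply/negP=> /andP[sub _].
have : s \in [set a; b] by rewrite -eab inE sF.
by rewrite in_set2 (negbTE sa) (negbTE sb).
Qed.

Lemma cycle_connect (z : chain T) a b : supp (mem (faces K d.+1)) z ->
  aug_boundary le z = 0 -> a \in faces K d.+1 -> b \in faces K d.+1 ->
  exists n : nat, z b = (-1) ^+ n * z a.
Proof.
move=> zK z0 aF bF; case: Kpm => _ _ _ conn.
have /connectP[p pp ->] := conn a b aF bF.
elim: p a {aF} pp => [|c p IH] a /=; first by exists 0%N; rewrite mul1r.
case/andP=> /(cycle_adjacent zK z0)[n en] /IH[m ->].
by exists (m + n)%N; rewrite en mulrA exprD.
Qed.

Definition unit_cycle (Z : chain T) : Prop :=
  [/\ supp (mem (faces K d.+1)) Z, aug_boundary le Z = 0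
    & forall s, s \in faces K d.+1 -> Z s = 1 \/ Z s = -1].

Lemma unit_cycle_generates (Z z : chain T) : unit_cycle Z ->
  supp (mem (faces K d.+1)) z -> aug_boundary le z = 0 ->
  exists m : int, z = Z *~ m.
Proof.
case=> ZK Z0 Z1 zK z0.
have [nF|/set0Pn[s sF]] := eqVneq (faces K d.+1) set0.
  exists 0; rewrite mulr0z; apply/ffunP=> s; rewrite ffunE; apply/eqP.
  by apply: contraT => /zK /=; rewrite nF inE.
(* Since [Z s] is a sign, this product is the quotient of [z s] by [Z s]; the difference vanishes at
   [s], hence everywhere by connectedness. *)
exists (z s * Z s); apply/eqP; rewrite -subr_eq0; apply/eqP.
set w := _ - _; have wK : supp (mem (faces K d.+1)) w by apply/suppB/suppMz.
have w0 : aug_boundary le w = 0 by rewrite raddfB raddfMz /= z0 Z0 mul0rz subr0.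
have ws : w s = 0.
  rewrite /w ffunE ffunE chainMzE.
  by case: (Z1 s sF) => ->; ring.
apply: supp_pred0 => t wt.
have [n] := cycle_connect wK w0 sF (wK t wt); rewrite ws mulr0 => e.
by rewrite e eqxx in wt.
Qed.

End TopCycles.

Lemma sphere_unit_cycle (T : finType) (le : rel T) d (K : {set {set T}}) :
  total_order le -> combinatorial_sphere d K -> exists Z, unit_cycle le d K Z.
Proof.
move=> leP [Kpm [V [gV [s0 [t0 [cV st cs ct]]]]]].
have Kc : is_complex K by case: Kpm.
have [Z [ZK Z0 Zs]] := top_cycle_exists leP Kc gV cV st cs ct.
exists Z; split=> // s sF.
have s0F : s0 \in faces K d.+1 by apply: ZK; rewrite Zs.
have [n ->] := cycle_connect leP Kpm ZK Z0 s0F sF.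
by rewrite Zs mulr1 -signr_odd; case: (odd n); rewrite ?expr0 ?expr1; [right|left].
Qed.

(** * Equivariant homotopies *)

Section Equivariance.
Variables (gT : finGroupType) (T : finType) (le : rel T) (K : {set {set T}}).
Variable to : {action gT &-> T}.
Hypotheses (leP : total_order le) (Kc : is_complex K).
Hypotheses (Kto : simplicial_action K to) (Kfree : free_action K to).

Definition push_act (g : gT) : chain T -> chain T := push le le (to^~ g).

HB.instance Definition _ g := GRing.Additive.on (push_act g).

Local Notation bd := (aug_boundary le).

Lemma push_actM g h c : push_act h (push_act g c) = push_act (g * h)%g c.
Proof.
rewrite /push_act push_comp //; apply: eq_in_push => s _ x _ /=.
by rewrite actM.
Qed.

Lemma push_act1 c : push_act 1%g c = c.
Proof. by apply: push_id => // x; rewrite act1. Qed.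

Lemma push_act_simplex g s : exists n : nat,
  push_act g (simplex_chain s) = simplex_chain ((to^*)%act s g) *~ (-1) ^+ n.
Proof. by apply: push_simplex_inj => //; apply: in2W; apply: act_inj. Qed.

Lemma push_act_boundary g c : push_act g (bd c) = bd (push_act g c).
Proof. exact: push_aug_boundary. Qed.

Lemma act_complex s g : ((to^*)%act s g \in K) = (s \in K).
Proof. by rewrite (acts_act Kto) ?inE. Qed.

Lemma card_act s g : #|(to^*)%act s g| = #|s|.
Proof. by rewrite card_imset //; apply: act_inj. Qed.

Lemma act_faces n s g : ((to^*)%act s g \in faces K n) = (s \in faces K n).
Proof. by rewrite !inE act_complex card_act. Qed.

Lemma supp_push_act n g c : supp (mem (faces K n)) c ->
  supp (mem (faces K n)) (push_act g c).
Proof.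
apply: supp_push => // s sK.
by rewrite -[_ @: _]/((to^*)%act s g) act_complex.
Qed.

Lemma free_act_inj s a b : s \in K -> s != set0 ->
  (to^*)%act s a = (to^*)%act s b -> a = b.
Proof.
move=> sK s0 eab; apply/eqP; rewrite eq_mulgV1; apply: contraT => ab.
by have := Kfree ab sK s0; rewrite actM eab -actM mulgV act1 eqxx.
Qed.

(* Choosing a simplex in each orbit trivializes the free action. *)
Lemma free_act_coordinate : exists e : {set T} -> gT,
  forall s g, s \in K -> s != set0 -> e ((to^*)%act s g) = (e s * g)%g.
Proof.
pose r s := odflt s [pick t in orbit (to^*)%act [set: gT] s].
pose e s := odflt 1%g [pick g | (to^*)%act (r s) g == s].
have rP s : r s \in orbit (to^*)%act [set: gT] s.
  by rewrite /r; case: pickP => //= _; apply: orbit_refl.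
have re s : (to^*)%act (r s) (e s) = s.
  rewrite /e; case: pickP => /= [g /eqP//|no].
  have /orbitP[g _ gs] := rP s; have := no g^-1%g.
  by rewrite -gs actK eqxx.
have rK s : s \in K -> r s \in K.
  by move=> sK; rewrite -(act_complex _ (e s)) re.
have r0 s : s != set0 -> r s != set0.
  by rewrite -!card_gt0 -{1}(re s) card_act.
(* The choice made by [pick] depends on the orbit alone, and its default is never reached. *)
have rg s g : r ((to^*)%act s g) = r s.
  have es : orbit (to^*)%act [set: gT] ((to^*)%act s g) = orbit (to^*)%act [set: gT] s.
    by apply: orbit_act; rewrite inE.
  rewrite /r es; case: pickP => //= no.
  by have := no s; rewrite orbit_refl.
exists e => s g sK s0; apply: (@free_act_inj (r s)); rewrite ?rK ?r0 //.
by rewrite -(rg s g) re rg actM re.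
Qed.

(** The fibres of the coordinate [e] are translates of the fibre over 1, which meets each orbit
    once, so all of them have the same sum. *)
Lemma sum_free_orbits n (w : {set T} -> int) : (0 < n)%N ->
  (forall s g, s \in faces K n -> w ((to^*)%act s g) = w s) ->
  exists m : int, \sum_(s in faces K n) w s = m *+ #|gT|.
Proof.
move=> n0 wg; have [e eP] := free_act_coordinate.
exists (\sum_(s in faces K n | e s == 1%g) w s).
rewrite (partition_big e predT) //= -cardsT -sumr_const big_mkcond /=.
rewrite [RHS]big_mkcond /=; apply: eq_bigr => g _; rewrite inE.
rewrite (reindex_inj (act_inj (to^*)%act g)) /=; apply: eq_big => s.
  rewrite act_faces; have [sF|//] := boolP (s \in faces K n).
  move: sF; rewrite inE => /andP[sK /eqP cs].
  by rewrite eP // -?card_gt0 ?cs // -{2}(mul1g g) (inj_eq (mulIg g)).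
by rewrite act_faces => /andP[sF _]; apply: wg.
Qed.

Variable phi : {additive chain T -> chain T}.
Hypothesis phi_bd : forall c, bd (phi c) = phi (bd c).
Hypothesis phi_set0 : phi (simplex_chain set0) = 0.
Hypothesis phi_supp :
  forall n c, supp (mem (faces K n)) c -> supp (mem (faces K n)) (phi c).
Hypothesis phi_act : forall s g, s \in K ->
  phi (push_act g (simplex_chain s)) = push_act g (phi (simplex_chain s)).

Variable d : nat.
Hypothesis K_exact : forall n c, (n <= d)%N -> supp (mem (faces K n)) c ->
  bd c = 0 -> exists2 b, supp (mem (faces K n.+1)) b & bd b = c.

(** Support and equivariance are required on all of [K], the homotopy relation only up to [n]
    vertices, so extending [h] means overriding it on one dimension. Equivariance goes through
    [lin h] because a translated simplex comes with a sign. *)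
Definition equivariant_homotopy n (h : {set T} -> chain T) : Prop :=
  [/\ forall s, s \in K -> supp (mem (faces K #|s|.+1)) (h s),
      forall s g, s \in K ->
        lin h (push_act g (simplex_chain s)) = push_act g (h s)
    & forall s, s \in K -> (#|s| <= n)%N ->
        bd (h s) + lin h (bd (simplex_chain s)) = phi (simplex_chain s)].

Section Defect.
Variables (n : nat) (h : {set T} -> chain T).
Hypothesis hP : equivariant_homotopy n h.

(** The boundary that [h] must have on [c] in the next dimension. It is a cycle, to be filled up to
    dimension [d - 1] and compared with [Z] in dimension [d]. *)
Definition defect (c : chain T) : chain T := phi c - lin h (bd c).

Lemma defect_zmod_morphism : zmod_morphism defect.
Proof.
move=> c c'; rewrite /defect (raddfB phi) (raddfB (aug_boundary le)) /=.
by rewrite (raddfB (lin h)) /= !opprD addrACA.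
Qed.

HB.instance Definition _ :=
  GRing.isZmodMorphism.Build _ _ defect defect_zmod_morphism.

Lemma supp_defect c : supp (mem (faces K n.+1)) c ->
  supp (mem (faces K n.+1)) (defect c).
Proof.
case: hP => hs _ _ cF; apply: suppB; first exact: phi_supp.
apply: (supp_lin (supp_aug_boundary leP Kc cF)) => s /=.
by rewrite inE => /andP[sK /eqP cs]; rewrite -cs; apply: hs.
Qed.

Lemma bd_defect c : supp (mem (faces K n.+1)) c -> bd (defect c) = 0.
Proof.
case: hP => _ _ hh cF; rewrite /defect raddfB /= phi_bd.
have bF := supp_aug_boundary leP Kc cF.
have e : bd (lin h (bd c)) + lin h (bd (bd c)) = phi (bd c).
  pose F : {additive chain T -> chain T} := (bd \o lin h) \+ (lin h \o bd).
  rewrite -[LHS]/(F (bd c)); apply: additive_eq_on => s /bF /=.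
  rewrite inE => /andP[sK /eqP cs]; rewrite /F /= lin_simplex.
  by apply: hh; rewrite ?cs.
by rewrite -e aug_boundaryK // raddf0 addr0 subrr.
Qed.

Lemma defect_act s g : s \in faces K n.+1 ->
  defect (push_act g (simplex_chain s)) = push_act g (defect (simplex_chain s)).
Proof.
case: hP => _ hg _ sF; have sK : s \in K by move: sF; rewrite inE => /andP[].
suff e : lin h (bd (push_act g (simplex_chain s))) =
         push_act g (lin h (bd (simplex_chain s))).
  rewrite /defect.
  rewrite (phi_act g sK).
  rewrite e.
  rewrite [RHS](raddfB (push_act g)).
  by [].
rewrite -push_act_boundary.
pose F : {additive chain T -> chain T} := lin h \o push_act g.
pose G : {additive chain T -> chain T} := push_act g \o lin h.
rewrite -[LHS]/(F _) -[RHS]/(G _); apply: additive_eq_on => t.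
move=> /(supp_aug_boundary_simplex leP) /(closed_facet Kc sK) tK.
by rewrite /F /G /= hg // lin_simplex.
Qed.

End Defect.

Lemma equivariant_homotopy_exists n : (n <= d)%N ->
  exists h, equivariant_homotopy n h.
Proof.
elim: n => [|n IH] nd.
  have lin0 c : lin (fun=> 0) c = 0 :> chain T.
    by apply: big1 => s _; rewrite mul0rz.
  exists (fun=> 0); split=> [s _|s g _|s sK].
  - exact: supp0.
  - by rewrite lin0 raddf0.
  by rewrite leqn0 cards_eq0 => /eqP->; rewrite lin0 raddf0 addr0 phi_set0.
have [h hP] := IH (ltnW nd).
have [e eP] := free_act_coordinate.
have [b bP] : exists b : {set T} -> chain T, forall s, s \in faces K n.+1 ->
    supp (mem (faces K n.+2)) (b s) /\ bd (b s) = defect h (simplex_chain s).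
  apply: (@fin_all_exists _ _ (fun s (x : chain T) => s \in faces K n.+1 ->
    supp (mem (faces K n.+2)) x /\ bd x = defect h (simplex_chain s))) => s.
  have [sF|sF] := boolP (s \in faces K n.+1); last by exists 0.
  have sS : supp (mem (faces K n.+1)) (simplex_chain s) by apply: supp_simplex.
  have [x xs xb] := K_exact nd (supp_defect hP sS) (bd_defect hP sS).
  by exists x.
(* Move [s] by the inverse of [e s] to the simplex of its orbit with coordinate 1, fill there with
   [b], and move back. Equivariance follows from [e] being multiplicative along orbits. *)
pose B g c := push_act g (lin b (push_act g^-1 c)).
pose h' (s : {set T}) := if #|s| == n.+1 then B (e s) (simplex_chain s) else h s.
have h'h (s : {set T}) : (#|s| <= n)%N -> h' s = h s.
  by rewrite /h' -ltnS => lts; rewrite ltn_eqF.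
have lin_h' (s : {set T}) : s \in K -> (#|s| <= n.+1)%N ->
    lin h' (bd (simplex_chain s)) = lin h (bd (simplex_chain s)).
  move=> sK les; apply: eq_lin => t /(supp_aug_boundary_simplex leP) /andP[_ /eqP ct].
  by apply: h'h; rewrite ct ltnS in les.
case: (hP) => hs hg hh; exists h'; split=> [s sK|s g sK|s sK les].
- rewrite /h'; case: eqP => [cs|_]; last exact: hs.
  rewrite cs; apply: supp_push_act; apply: (@supp_lin _ _ (mem (faces K n.+1))).
    by apply: supp_push_act; apply: supp_simplex; rewrite /= inE sK cs eqxx.
  by move=> t /bP[].
- have [k ek] := push_act_simplex g s.
  rewrite ek raddfMz /= lin_simplex /h' card_act.
  case: eqP => [cs|_]; last by rewrite -hg // ek raddfMz /= lin_simplex.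
  have s0 : s != set0 by rewrite -card_gt0 cs.
  rewrite /B -!raddfMz /= -ek eP // push_actM -push_actM.
  congr (push_act _ (push_act _ (lin b _))).
  by rewrite invMg mulKVg.
rewrite lin_h' //; have [cs|cs|cs] := ltngtP #|s| n.+1; last 1 first.
- rewrite /h' cs eqxx /B.
  have sF : s \in faces K n.+1 by rewrite inE sK cs eqxx.
  rewrite -push_act_boundary.
  have -> : bd (lin b (push_act (e s)^-1 (simplex_chain s))) =
            defect h (push_act (e s)^-1 (simplex_chain s)).
    pose F : {additive chain T -> chain T} := bd \o lin b.
    rewrite -[LHS]/(F _); apply: additive_eq_on => t tn.
    rewrite /F /= lin_simplex; apply: (bP t _).2.
    suff /(_ t tn) : supp (mem (faces K n.+1)) (push_act (e s)^-1 (simplex_chain s)).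
      by [].
    by apply: supp_push_act; apply: supp_simplex.
  by rewrite (defect_act hP) // push_actM mulVg push_act1 /defect subrK.
- by rewrite h'h // hh.
by rewrite ltnNge les in cs.
Qed.

Lemma chain_unit_inj (Z : chain T) s (a b : int) :
  Z s = 1 \/ Z s = -1 -> Z *~ a = Z *~ b -> a = b.
Proof.
move=> Zs /(congr1 (fun x : chain T => x s)); rewrite !chainMzE.
by case: Zs => ->; rewrite ?mul1r // !mulN1r => /oppr_inj.
Qed.

Lemma equivariant_degree0 Z M s1 : pseudomanifold d K ->
  unit_cycle le d K Z -> s1 \in faces K d.+1 -> phi Z = Z *~ M ->
  exists m : int, M = m *+ #|gT|.
Proof.
move=> Kpm ZU s1F phiZ; case: (ZU) => ZK Z0 Z1.
have [h hP] := equivariant_homotopy_exists (leqnn d).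
have supp1 s : s \in faces K d.+1 -> supp (mem (faces K d.+1)) (simplex_chain s).
  by move=> sF; apply: supp_simplex.
have [m mP] : exists m : {set T} -> int, forall s, s \in faces K d.+1 ->
    defect h (simplex_chain s) = Z *~ m s.
  apply: (@fin_all_exists _ _ (fun s (x : int) => s \in faces K d.+1 ->
    defect h (simplex_chain s) = Z *~ x)) => s.
  have [sF|sF] := boolP (s \in faces K d.+1); last by exists 0.
  have [x ex] := unit_cycle_generates leP Kpm ZU (supp_defect hP (supp1 s sF))
    (bd_defect hP (supp1 s sF)).
  by exists x.
have [|k ek] := @sum_free_orbits d.+1 (fun s => m s * Z s) isT.
  move=> s g sF; have gsF : (to^*)%act s g \in faces K d.+1 by rewrite act_faces.
  have [l el] := push_act_simplex g s.
  (* The action of [g] on the orientation is recorded by [chi], and that on the simplex [s] by the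
     sign with exponent [l]. Both relate [m] and [Z] at the translate to their values at [s], and
     they cancel in the product. *)
  have [chi echi] : exists chi : int, push_act g Z = Z *~ chi.
    apply: (unit_cycle_generates leP Kpm ZU); first exact: supp_push_act.
    by rewrite -push_act_boundary Z0 raddf0.
  have Zg : chi * Z ((to^*)%act s g) = (-1) ^+ l * Z s.
    have := congr1 (fun x : chain T => x ((to^*)%act s g)) echi.
    rewrite chainMzE mulrC => <-; rewrite [LHS]linE (bigD1 s) //= big1 ?addr0.
      rewrite -(lin_simplex (fun t => osimplex le (map (to^~ g) (vseq le t)))).
      rewrite -/(push le le _ _) -/(push_act g _) el chainMzE ffunE eqxx.
      by rewrite mul1r.
    move=> t ts.
    rewrite -(lin_simplex (fun t => osimplex le (map (to^~ g) (vseq le t)))).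
    rewrite -/(push le le _ _) -/(push_act g _).
    have [j ->] := push_act_simplex g t; rewrite chainMzE ffunE (inj_eq (act_inj _ g)).
    by rewrite eq_sym (negbTE ts) !mul0r.
  have mg : m ((to^*)%act s g) * (-1) ^+ l = chi * m s.
    apply: (@chain_unit_inj Z s1); first exact: Z1.
    rewrite mulrzA -mP // -(raddfMz (defect h)) /= -el (defect_act hP) // mP //.
    by rewrite (raddfMz (push_act g)) /= echi -mulrzA.
  have sq1 (x : int) : x = 1 \/ x = -1 -> x * x = 1 by case=> ->.
  have eps1 : (-1) ^+ l = 1 :> int \/ (-1) ^+ l = -1 :> int.
    by rewrite -signr_odd; case: (odd l); rewrite ?expr0 ?expr1; [right|left].
  move: (sq1 _ (Z1 _ gsF)) (sq1 _ eps1) mg Zg.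
  move: (m _) (Z _) (m s) (Z s) ((-1) ^+ l) => m' z' m0 z eps z'2 eps2 mg Zg.
  have -> : m' = chi * m0 * eps by rewrite -mg -mulrA eps2 mulr1.
  have -> : chi = eps * z * z' by rewrite -Zg -mulrA z'2 mulr1.
  have -> : eps * z * z' * m0 * eps * z' = (eps * eps) * (z' * z') * (m0 * z) by ring.
  by rewrite eps2 z'2 !mul1r.
exists k; rewrite -ek; apply: (@chain_unit_inj Z s1); first exact: Z1.
(* As [Z] is a cycle, the homotopy term drops out; expanding [Z] over simplices exhibits [M] as the
   sum of the products [m s * Z s]. *)
rewrite -phiZ; have -> : phi Z = defect h Z by rewrite /defect Z0 raddf0 subr0.
rewrite {1}[Z]chain_sumE raddf_sum /= mulrz_sumr.
rewrite [RHS](big_mkcond (mem (faces K d.+1))) /=.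
apply: eq_bigr => s _; rewrite raddfMz /=; case: ifP => [sF|sF].
  by rewrite mP // -mulrzA.
have [->|/ZK /=] := eqVneq (Z s) 0; first by rewrite mulr0z.
by rewrite sF.
Qed.

End Equivariance.

(** * Iterated subdivisions and the degree *)

(** Separate from [unit_cycle], since on a subdivision this property is transferred from the
    original complex and not deduced from strong connectedness. *)
Definition generates_top_cycles (T : finType) (le : rel T) (d : nat)
    (K : {set {set T}}) (Z : chain T) : Prop :=
  forall z, supp (mem (faces K d.+1)) z -> aug_boundary le z = 0 ->
    exists m : int, z = Z *~ m.

(** A flag with [d + 1] members has a top-dimensional simplex as union, and its coefficient is up to
    sign the one of that simplex. *)
Lemma unit_cycle_subdiv (T : finType) (le : rel T) (le' : rel {set T}) d
    (K : {set {set T}}) Z :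
  total_order le -> total_order le' -> is_complex K ->
  (forall s, s \in K -> (#|s| <= d.+1)%N) ->
  unit_cycle le d K Z -> unit_cycle le' d (Bd K) (subdiv le le' Z).
Proof.
move=> leP leP' Kc Kd [ZK Z0 Z1]; split; first exact: supp_subdiv.
  by rewrite aug_boundary_subdiv // Z0 raddf0.
move=> A; rewrite inE => /andP[AK /eqP cA].
have nA : A != set0 by rewrite -card_gt0 cA.
have [|n ->] := subdiv_coef leP leP' _ (Bd_flag AK) (Bd_set0 AK) cA (c := Z).
  by apply: supp_weaken _ ZK => s /=; rewrite inE => /andP[].
have [cK _] := cover_Bd AK nA.
have cF : cover A \in faces K d.+1.
  by rewrite inE cK eqn_leq Kd // -cA card_flag ?(Bd_flag AK) ?(Bd_set0 AK).
rewrite -signr_odd; case: (odd n); rewrite ?expr0 ?expr1 ?mul1r ?mulN1r //.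
by case: (Z1 _ cF) => ->; [right | left; rewrite opprK].
exact: Z1.
Qed.

Lemma generates_top_cycles_subdiv (T : finType) (le : rel T) (le' : rel {set T})
    d (K : {set {set T}}) Z :
  total_order le -> total_order le' -> is_complex K ->
  (forall s, s \in K -> (#|s| <= d.+1)%N) ->
  generates_top_cycles le d K Z ->
  generates_top_cycles le' d (Bd K) (subdiv le le' Z).
Proof.
move=> leP leP' Kc Kd genZ z zK z0.
have [ez|/eqP nz] := eqVneq z 0; first by exists 0; rewrite mulr0z.
(* The vertex choice [v] needs a default at the empty set; a nonzero [z] supplies an element of
   [T]. *)
have [x _] : exists x : T, true.
  case: (pickP (fun A => z A != 0)) => [A zA|all0]; last first.
    by case: nz; apply/ffunP=> A; rewrite ffunE; apply/eqP; have /negbFE := all0 A.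
  have := zK A zA; rewrite /= inE => /andP[AK /eqP cA].
  have nA : A != set0 by rewrite -card_gt0 cA.
  by have [_ /set0Pn[x _]] := cover_Bd AK nA; exists x.
pose v (s : {set T}) := odflt x [pick y in s].
have vP s : s != set0 -> v s \in s.
  by case/set0Pn=> y ys; rewrite /v; case: pickP => [//|/(_ y)]; rewrite ys.
have ez := subdiv_top_cycle leP leP' vP Kc Kd isT zK z0.
have [||m em] := genZ (push le' le v z).
- exact: (supp_push leP' leP (simplicial_map_top Kc vP)).
- by rewrite -push_aug_boundary // z0 raddf0.
by exists m; rewrite -ez em raddfMz.
Qed.

Section Iterated.
Variables (T : finType) (S : {set {set T}}) (le : forall j, rel (bdV T j)).
Arguments le : clear implicits.
Hypotheses (leP : forall j, total_order (le j)) (Sc : is_complex S).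

Fixpoint iter_subdiv (k : nat) : chain T -> chain (bdV T k) :=
  if k is k'.+1 then
    fun c => @subdiv (bdV T k') (le k') (le k'.+1) (iter_subdiv k' c)
  else id.

Lemma iter_subdiv_zmod_morphism k : zmod_morphism (iter_subdiv k).
Proof.
elim: k => [//|k IH] c c'; rewrite [LHS]/= IH.
exact: (raddfB (@subdiv (bdV T k) (le k) (le k.+1))).
Qed.

HB.instance Definition _ k :=
  GRing.isZmodMorphism.Build _ _ (iter_subdiv k) (@iter_subdiv_zmod_morphism k).

Lemma iter_Bd_complex k : is_complex (iter_Bd S k).
Proof. by case: k => [//|k]; apply: Bd_complex. Qed.

Lemma card_iter_Bd N k : (forall s, s \in S -> (#|s| <= N)%N) ->
  forall s, s \in iter_Bd S k -> (#|s| <= N)%N.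
Proof.
move=> SN; elim: k => [//|k IH] s.
exact: (card_Bd (iter_Bd_complex k) IH).
Qed.

Lemma supp_iter_subdiv n k c : supp (mem (faces S n)) c ->
  supp (mem (faces (iter_Bd S k) n)) (iter_subdiv k c).
Proof.
move=> cS; elim: k => [//|k IH].
exact: (supp_subdiv (leP k) (leP k.+1) (iter_Bd_complex k) IH).
Qed.

Lemma iter_subdiv_boundary k c :
  aug_boundary (le k) (iter_subdiv k c) = iter_subdiv k (aug_boundary (le 0) c).
Proof.
elim: k => [//|k IH].
by rewrite [in LHS]/= (aug_boundary_subdiv (leP k) (leP k.+1)) IH.
Qed.

Lemma iter_subdiv_set0 k :
  iter_subdiv k (simplex_chain set0) = simplex_chain set0.
Proof. by elim: k => [//|k IH]; rewrite /= IH subdiv_set0. Qed.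

Lemma iter_subdiv_chainE k q c : supp (mem (faces S q.+1)) c ->
  iter_subdiv_chain S le k q c = iter_subdiv k c.
Proof.
move=> cS; elim: k => [//|k IH].
rewrite -[LHS]/(@subdiv_chain (bdV T k) (iter_Bd S k) (le k) (le k.+1) q
  (iter_subdiv_chain S le k q c)) IH.
exact: (subdiv_chainE (leP k) (leP k.+1) (iter_Bd_complex k) (supp_iter_subdiv cS)).
Qed.

Lemma iter_subdiv_act (gT : finGroupType) (to : {action gT &-> T}) k g c :
  iter_subdiv k (push (le 0) (le 0) (to^~ g) c) =
  push (le k) (le k) ((iter_act to k)^~ g) (iter_subdiv k c).
Proof.
elim: k => [//|k IH]; rewrite /= IH; apply/esym.
exact: (subdiv_push _ (leP k) (leP k.+1) (leP k) (leP k.+1) (act_inj (iter_act to k) g)).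
Qed.

Lemma iter_unit_cycle d k Z : (forall s, s \in S -> (#|s| <= d.+1)%N) ->
  unit_cycle (le 0) d S Z ->
  unit_cycle (le k) d (iter_Bd S k) (iter_subdiv k Z).
Proof.
move=> Sd ZU; elim: k => [//|k IH].
exact: (unit_cycle_subdiv (leP k) (leP k.+1) (iter_Bd_complex k) (card_iter_Bd Sd) IH).
Qed.

Lemma iter_generates_top_cycles d k Z : (forall s, s \in S -> (#|s| <= d.+1)%N) ->
  generates_top_cycles (le 0) d S Z ->
  generates_top_cycles (le k) d (iter_Bd S k) (iter_subdiv k Z).
Proof.
move=> Sd ZG; elim: k => [//|k IH].
exact: (generates_top_cycles_subdiv (leP k) (leP k.+1) (iter_Bd_complex k)
  (card_iter_Bd Sd) IH).
Qed.

End Iterated.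

(** Equivariance is assumed for simplices as sets; at singletons it becomes commutation on vertices,
    from which both composites agree. *)
Lemma equivariant_push (gT : finGroupType) (T1 T2 : finType) (le1 : rel T1)
    (le2 : rel T2) (K1 : {set {set T1}}) (to1 : {action gT &-> T1})
    (to2 : {action gT &-> T2}) (f : T1 -> T2) g n (c : chain T1) :
  total_order le1 -> total_order le2 -> is_complex K1 ->
  equivariant K1 to1 to2 f -> supp (mem (faces K1 n)) c ->
  push le1 le2 f (push le1 le1 (to1^~ g) c) =
  push le2 le2 (to2^~ g) (push le1 le2 f c).
Proof.
move=> leP1 leP2 [_ Kcl] fE cK; rewrite !push_comp //.
apply: eq_in_push => s /cK /=; rewrite inE => /andP[sK _] x xs /=.
have xK : [set x] \in K1 by apply: Kcl sK _; rewrite sub1set.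
have := fE g _ xK; rewrite /= /setact !imset_set1.
by move/set1_inj.
Qed.

Lemma fund_cycleE (T : finType) (K : {set {set T}}) d (c : {ffun {set T} -> int})
    s :
  fund_cycle K d c s = if s \in faces K d.+1 then c s else 0.
Proof.
rewrite /fund_cycle sum_ffunE; case: ifP => sF.
  rewrite (bigD1 s) //= chainMzE ffunE eqxx mul1r big1 ?addr0 // => t /andP[_ ts].
  by rewrite chainMzE ffunE eq_sym (negbTE ts) mul0r.
rewrite big1 // => t tF; rewrite chainMzE ffunE.
by case: (s =P t) tF => [<-|]; rewrite ?sF // mul0r.
Qed.

Lemma supp_fund_cycle (T : finType) (K : {set {set T}}) d
    (c : {ffun {set T} -> int}) : supp (mem (faces K d.+1)) (fund_cycle K d c).
Proof. by move=> s; rewrite fund_cycleE /=; case: ifP; rewrite ?eqxx. Qed.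

Theorem theorem1p7 (p : nat) (p_prime : prime p) (k d : nat)
    (T : finType) (S : {set {set T}})
    (le : forall j : nat, rel (bdV T j))
    (le_total : forall j : nat, total_order (le j))
    (to : {action 'Z_p &-> T})
    (S_sphere : Zp_combinatorial_sphere d S to)
    (f : bdV T k -> T)
    (f_simplicial : simplicial_map (iter_Bd S k) S f)
    (f_equivariant : equivariant (iter_Bd S k) (iter_act to k) to f) :
  (exists m : int, is_degree S le d f m) /\
  (forall m : int, is_degree S le d f m -> (m = 1 %[mod p%:Z])%Z).
Proof.
have [sphS actS freeS] := S_sphere.
have [Spm [V [gV [s0 [t0 [critV s0t0 cs0 ct0]]]]]] := sphS.
have Sc : is_complex S by case: Spm.
have Scard := pseudomanifold_card Spm.
have [Z ZU] := sphere_unit_cycle (le_total 0%N) sphS.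
have ZG : generates_top_cycles (le 0%N) d S Z.
  by move=> z; apply: (unit_cycle_generates (le_total 0%N) Spm ZU).
pose K := iter_Bd S k.
pose sd : {additive chain T -> chain (bdV T k)} := iter_subdiv le k.
pose fp : {additive chain (bdV T k) -> chain T} := push (le k) (le 0%N) f.
have Kc : is_complex K by apply: iter_Bd_complex.
have sZU : unit_cycle (le k) d K (sd Z).
  exact: (iter_unit_cycle le_total Sc k Scard ZU).
have sZG : generates_top_cycles (le k) d K (sd Z).
  exact: (iter_generates_top_cycles le_total Sc Scard ZG).
have [ZS Z0 Z1] := ZU; have [sZK sZ0 sZ1] := sZU.
have fp_supp n c : supp (mem (faces K n)) c -> supp (mem (faces S n)) (fp c).
  exact: (supp_push (le_total k) (le_total 0%N) f_simplicial).
have fp_bd c : aug_boundary (le 0%N) (fp c) = fp (aug_boundary (le k) c).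
  exact/esym/(push_aug_boundary (le_total k) (le_total 0%N)).
have [m0 em0] : exists m0 : int, fp (sd Z) = Z *~ m0.
  by apply: ZG; [apply: fp_supp | rewrite fp_bd sZ0 raddf0].
have degE c : supp (mem (faces K d.+1)) c ->
    iter_subdiv_chain S le k d (map_chain K (le k) (le 0%N) f d c) = sd (fp c).
  move=> cK; rewrite map_chainE //.
  exact: (iter_subdiv_chainE le_total Sc k (fp_supp _ _ cK)).
have phiZ : fp (sd Z) - Z = Z *~ (m0 - 1) by rewrite em0 mulrzBr mulr1z.
have s0F : s0 \in faces S d.+1 by rewrite inE (s0_K critV) cs0 eqxx.
have [m em] : exists m : int, m0 - 1 = m *+ p.
  pose phi : {additive chain T -> chain T} := (fp \o sd) \- idfun.
  have -> : p = #|'Z_p| by rewrite card_ord Zp_cast // prime_gt1.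
  apply: (@equivariant_degree0 _ T (le 0%N) S to (le_total 0%N) Sc actS freeS phi
    _ _ _ _ d _ Z (m0 - 1) s0) => //.
  - move=> c; rewrite /phi /= (raddfB (aug_boundary (le 0%N))) /= fp_bd.
    by rewrite /sd iter_subdiv_boundary.
  - rewrite /phi /sd /fp /= iter_subdiv_set0 //.
    by rewrite (push_set0 (le_total k) (le_total 0%N)) subrr.
  - move=> n c cS; apply: (suppB _ cS); apply: fp_supp.
    exact: (supp_iter_subdiv le_total Sc cS).
  - move=> s g sS; rewrite /phi /= (raddfB (push_act (le 0%N) to g)) /=.
    congr (_ - _); rewrite /sd /push_act iter_subdiv_act //.
    have sK : supp (mem (faces K #|s|)) (sd (simplex_chain s)).
      apply: (supp_iter_subdiv le_total Sc (n := #|s|)); apply: supp_simplex.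
      by rewrite /= inE sS eqxx.
    exact: (equivariant_push g (le_total k) (le_total 0%N) Kc f_equivariant sK).
  move=> n c nd cS c0.
  by have [b [bS _ eb]] := sphere_exact (le_total 0%N) Sc gV critV s0t0 cs0 ct0 nd cS c0;
    exists b.
have m0_mod : (m0 = 1 %[mod p%:Z])%Z.
  by rewrite -(subrK 1 m0) em -mulr_natr natz modzMDl.
(* Comparing multiples of an orientation needs a [d]-simplex of the subdivision. Without one the
   subdivided [Z] would be 0 and so would [m0], against [m0] being 1 modulo [p]. *)
have [A AK] : exists A, A \in faces K d.+1.
  apply/set0Pn; apply/negP=> /eqP nK; have sdZ0 : sd Z = 0.
    by apply: supp_pred0 => A /sZK; rewrite /= nK inE.
  have : m0 = 0.
    apply: (@chain_unit_inj _ Z s0); first exact: Z1.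
    by rewrite -em0 sdZ0 raddf0 mulr0z.
  move=> m00; move: m0_mod; by rewrite m00 mod0z modz_small // ltz_nat prime_gt1.
split.
  (* The subdivided fundamental cycle, read as a function on simplices, is itself an orientation. *)
  exists m0, (sd Z); split.
    split; first exact: sZ1.
    have -> : fund_cycle K d (sd Z) = sd Z.
      apply/ffunP=> s; rewrite fund_cycleE; case: ifPn => // sK.
      by apply/esym/eqP; apply: contraNT sK => /sZK.
    case: (d) sZK sZ0 => [//|q] sZK' sZ0'.
    by rewrite boundaryE.
  have -> : fund_cycle K d (sd Z) = sd Z.
    apply/ffunP=> s; rewrite fund_cycleE; case: ifPn => // sK.
    by apply/esym/eqP; apply: contraNT sK => /sZK.
  by rewrite degE // em0 raddfMz.
move=> m' [xi [[xi1 xi0]]].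
set F := fund_cycle K d xi.
have FK : supp (mem (faces K d.+1)) F by apply: supp_fund_cycle.
have FA : F A = 1 \/ F A = -1 by rewrite /F fund_cycleE AK; apply: xi1.
rewrite degE // => eF.
(* When the augmented boundary of [F] vanishes too, [F] is a multiple of [sd Z] and inherits the
   factor [m0]. *)
have [F0|nF0] := eqVneq (aug_boundary (le k) F) 0.
  have [n en] := sZG F FK F0.
  suff -> : m' = m0 by [].
  apply: (chain_unit_inj FA); rewrite -eF en !raddfMz /= em0 raddfMz /=.
  by rewrite -!mulrzA mulrC.
have bdF0 : (0 < d)%N -> aug_boundary (le k) F = 0.
  move: xi0 FK; rewrite /F; case: (d) => // q xi0 FK _.
  by rewrite -(boundaryE (le_total k) Kc FK).
have d0 : d = 0%N by case: (posnP d) nF0 => // /bdF0 ->; rewrite eqxx.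
(* Now [d = 0] and [w] is the nonzero augmentation of [F]; both chain maps preserve it, so
   [w = w * m']. *)
have [w ew] : exists w : int, aug_boundary (le k) F = simplex_chain set0 *~ w.
  have bF : supp (mem (faces K d)) (aug_boundary (le k) F) by apply: supp_aug_boundary.
  exists (aug_boundary (le k) F set0); apply/ffunP=> s; rewrite chainMzE ffunE.
  have [->|s_n0] := eqVneq s set0; first by rewrite mul1r.
  rewrite mul0r; apply/eqP; apply: contraNT s_n0 => /bF /=.
  by rewrite d0 inE cards_eq0 => /andP[].
suff -> : m' = 1 by [].
have := congr1 (aug_boundary (le k)) eF.
rewrite /sd iter_subdiv_boundary // fp_bd raddfMz /= ew !raddfMz /=.
rewrite /fp /sd /= (push_set0 (le_total k) (le_total 0%N)) iter_subdiv_set0 // -mulrzA.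
move/(congr1 (fun x : chain (bdV T k) => x set0)); rewrite !chainMzE ffunE eqxx !mul1r.
have w0 : w != 0 by apply: contraNneq nF0 => w0; rewrite ew w0 mulr0z.
by rewrite -{1}[w]mulr1 => /(mulfI w0).
Qed.
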